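(* For every odd integer $n \leq 555$ such that there exists a non-abelian group of order $n$, there exists at least one sequenceable group of order $n$.
   Context: Let $G$ be a finite group of order $n$. For an arrangement $\mathbf{a}=(a_1,\dots,a_n)$ of all elements of $G$, define $b_i = a_i^{-1}a_{i+1}$ for $1\le i\le n-1$. If $b_1,\dots,b_{n-1}$ are pairwise distinct, $(b_1,\dots,b_{n-1})$ is a sequencing of $G$, and $G$ is called sequenceable if it has a sequencing. *)

(* Defs.v *)
From mathcomp Require Import all_boot all_fingroup.
Set Implicit Arguments. Unset Strict Implicit. Unset Printing Implicit Defensive.
Local Open Scope group_scope.

Definition quotients_seq (gT : finGroupType) (s : seq gT) : seq gT :=
  [seq (nth 1 s i)^-1 * nth 1 s i.+1 | i <- iota 0 (size s).-1].

Definition sequenceable (gT : finGroupType) : Prop :=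
  exists s : seq gT, perm_eq s (enum gT) /\ uniq (quotients_seq s).

(* Main.v *)
From HB Require Import structures.
Require Import Defs.
From Stdlib Require Import NArith.
From mathcomp Require Import all_boot all_algebra all_fingroup all_solvable.
From mathcomp Require Import zify.
Set Implicit Arguments. Unset Strict Implicit. Unset Printing Implicit Defensive.
Import GRing.Theory FiniteModule.
Local Open Scope group_scope.

(* A group G of order n is abelian as soon as n is cube-free and no prime q
   dividing n divides p^v - 1, where p^v is the exact power of a prime p in n.
   Indeed each Sylow p-subgroup P is then abelian, and central in its normaliser:
   counting fixed points modulo q, a q-group with q != p acts non-trivially on P
   only if q divides |P| - 1. Burnside's transfer argument then shows that p does
   not divide |G'|. This leaves 72 odd orders up to 555. For each of them an
   explicit sequencing b of a semidirect product is listed, and it suffices to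
   check by computation that the b_i are distinct and that so are their partial
   products. *)

(** An abelian group of odd order n > 1 is never sequenceable: the b_i would be its n - 1
    non-trivial elements, whose product is 1, so that a_n would equal a_1. Orders all of whose
    groups are abelian must therefore be separated from the others, and this is the sole purpose of
    the group theory below. For each remaining order a single group is enough, so it can be chosen
    for the simplicity of its arithmetic: the normal subgroup is Z_m or Z_m^2, and a cyclic group
    acts on it through the powers of one automorphism. The shape of the rest is dictated by the
    computation. Group elements are coded by binary integers, a sequence is tested entirely on
    codes, and a map compatible with products carries the result back to the group. The search that
    produced the sequences need not be trusted, since everything it claims is tested again. *)

(** * Orders of which every group is abelian *)

(** The fixed points of [A] acting on [P] by conjugation form ['C_P(A)], of order p^d say, and their
    number is congruent to p^e modulo q. If d < e, then q divides p^e - p^d, hence p^(e-d) - 1 since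
    q differs from p. As e is at most 2, the difference e - d is 1 or e, and in both cases p^(e-d) -
    1 divides p^e - 1, against the hypothesis on q. *)
Lemma pgroup_cent_small (gT : finGroupType) (p q e : nat) (P A : {group gT}) :
    prime p -> prime q -> p != q -> #|P| = (p ^ e)%N -> e <= 2 ->
    ~~ (q %| (p ^ e).-1) -> q.-group A -> A \subset 'N(P) ->
  A \subset 'C(P).
Proof.
move=> p_pr q_pr p'q oP le_e2 ndv qA nPA; rewrite centsC.
have actsA : [acts A, on P | 'J] by rewrite astabsJ.
have := pgroup_fix_mod qA actsA; rewrite afixJ oP => /eqP eq_mod.
have [d le_de oC] : exists2 d, d <= e & #|'C_P(A)| = (p ^ d)%N.
  by apply/(dvdn_pfactor _ _ p_pr); rewrite -oP cardSg ?subsetIl.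
move: eq_mod; rewrite oC; move: le_de; rewrite leq_eqVlt.
case/orP=> [/eqP def_d _ | lt_de].
  by apply/setIidPl/eqP; rewrite eqEcard subsetIl oP oC def_d leqnn.
rewrite eqn_mod_dvd ?leq_pexp2l ?prime_gt0 1?ltnW //.
rewrite -{1}(subnKC (ltnW lt_de)) expnD -{2}[(p ^ d)%N]muln1 -mulnBr.
rewrite Gauss_dvdr; last by rewrite coprimeXr ?prime_coprime ?dvdn_prime2 1?eq_sym.
move=> dvq; case/negP: ndv; apply: dvdn_trans dvq _.
(* The surviving pairs (e, d) are (1, 0), (2, 0) and (2, 1). In the first two e - d = e; the last
   one rests on p - 1 dividing p^2 - 1. *)
case: e lt_de le_e2 {oP} => [|[|[|//]]]; case: {oC}d => [|[|//]] //= _ _;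
  rewrite ?subn1 //.
rewrite -[(_ ^ 2).-1]subn1 -[X in _ ^ 2 - X](exp1n 2) subn_sqr expn1 -subn1.
exact: dvdn_mulr.
Qed.

(** Burnside's fusion argument: two elements of an abelian Sylow subgroup that are conjugate in [G]
    are already conjugate in its normaliser. Here the normaliser centralises [P], so such elements
    are equal. *)
Lemma fusion_cent_norm_Sylow (gT : finGroupType) (p : nat) (G P : {group gT}) :
    p.-Sylow(G) P -> abelian P -> 'N_G(P) \subset 'C(P) ->
  {in P & G, forall u y, u ^ y \in P -> u ^ y = u}.
Proof.
move=> sylP cPP cNP u y Pu Gy Puy; have sPG := pHall_sub sylP.
have sylPC : p.-Sylow('C_G[u ^ y]) P.
  apply: pHall_subl (subsetIl _ _) sylP.
  by rewrite subsetI sPG sub_cent1 (subsetP cPP).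
(* Since [P] is abelian it centralises [u], so [P :^ y] centralises [u ^ y]. *)
have sylPyC : p.-Sylow('C_G[u ^ y]) (P :^ y).
  apply: (pHall_subl _ (subsetIl _ _)); last by rewrite pHallJ.
  rewrite subsetI -{1}(conjGid Gy) conjSg sPG sub_cent1.
  by rewrite centJ memJ_conjg (subsetP cPP).
(* Sylow's theorem inside the centraliser of [u ^ y]: some [c] fixing [u ^ y] carries [P :^ y] back
   to [P]. Then [y * c] normalises [P], hence fixes [u], while it also sends [u] to [u ^ y]. *)
have [c /setIP[Gc cuyc] defP] := Sylow_trans sylPyC sylPC.
have Nyc : y * c \in 'N_G(P).
  by rewrite inE groupM //=; apply/normP; rewrite conjsgM -defP.
have /commgP/conjg_fixP := commute_sym (centP (subsetP cNP _ Nyc) u Pu).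
rewrite conjgM => {2}<-; apply/esym/conjg_fixP/commgP.
exact/commute_sym/cent1P.
Qed.

(* On P the transfer G -> P is the |G : P|-th power map, by the fusion lemma. *)
Lemma der1_p'group_cent_norm (gT : finGroupType) (p : nat) (G P : {group gT}) :
    p.-Sylow(G) P -> abelian P -> 'N_G(P) \subset 'C(P) ->
  p^'.-group G^`(1).
Proof.
move=> sylP cPP cNP; have [sPG pP p'i] := and3P sylP.
(* The transfer is built from a morphism of [P] with abelian image; here it is the identity of
   [P]. *)
have abP : abelian (idm P @* P) by rewrite morphim_idm.
pose V := [morphism of transfer G abP].
have tiVP : P :&: 'ker V = 1.
  apply/trivgP/subsetP=> g /setIP[Pg /setIP[_ /[!inE] /eqP Vg1]].
  have Gg := subsetP sPG g Pg.
  (* [X] represents the orbits of [<[g]>] on the right cosets of [P]; the index [#|<[g]> : P :* x|]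
     is the length of the orbit of [P :* x]. *)
  have [X trX] : exists X, is_transversal X (rcosets P G :* <[g]>) G.
    exists (transversal (rcosets P G :* <[g]>) G).
    exact/transversalP/rcosets_cycle_partition.
  have sXG := subsetP (transversal_sub trX).
  have := transfer_cycle_expansion sPG abP Gg trX; rewrite -[LHS]/(V g) Vg1.
  rewrite (eq_bigr (fun x => fmod abP g *+ #|<[g]> : P :* x|)%R); last first.
    move=> x Xx; rewrite /restrm /=.
    (* This power of [g] fixes the coset [P :* x], so its conjugate by [x^-1] lies in [P]; by the
       fusion lemma the conjugation then has no effect. *)
    have Pgx : (g ^+ #|<[g]> : P :* x|) ^ x^-1 \in P.
      have := mulg_exp_card_rcosets P g x; rewrite mem_rcoset.
      by rewrite conjgE invgK mulgA.
    rewrite (fusion_cent_norm_Sylow sylP) ?groupX ?groupV ?sXG //.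
    by rewrite fmodX //= morphim_idm.
  (* The orbit lengths add up to the index of [P], so [V g] is the power of [g] with that exponent.
     If it is trivial, the order of [g] divides an integer prime to p; being a power of p, it is
     1. *)
  rewrite GRing.sumrMnr (sum_index_rcosets_cycle sPG Gg trX) => /esym/congr_fmod.
  rewrite fmvalZ fmval0 fmodK => [gi1|]; last by rewrite /= morphim_idm.
  rewrite -order_eq1 (pnat_1 (mem_p_elt pP Pg)) //.
  by apply: pnat_dvd p'i; rewrite order_dvdn gi1.
have sG'V : G^`(1) \subset 'ker V.
  rewrite -sub_morphim_pre ?der_sub // morphim_der //.
  exact/trivgP/derG1P/FinRing.zmod_abelian.
have nsV : 'ker V <| G := ker_normal V.
(* A normal subgroup meets [P] in one of its own Sylow subgroups. The intersection is trivial, so p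
   does not divide the order of the kernel, nor that of the derived subgroup inside it. *)
have sylV : p.-Sylow('ker V) (P :&: 'ker V).
  by rewrite setIC; apply: Sylow_setI_normal sylP.
rewrite tiVP in sylV.
by apply: pgroupS sG'V _; rewrite -partG_eq1 -(card_Hall sylV) cards1.
Qed.

(** By a theorem of Dickson the positive n that pass are exactly those for which every group of
    order n is abelian; sufficiency is what is proved below. The inner test may range over q = p as
    well, because p never divides p^v - 1 when v > 0. *)
Definition abelian_order n :=
  all (fun p => (logn p n <= 2) &&
    all (fun q => ~~ (q %| (p ^ logn p n).-1)) (primes n)) (primes n).

(** If the derived subgroup is non-trivial, some prime p divides its order. A Sylow p-subgroup has
    order p or p^2, hence is abelian, and once it is shown to be central in its normaliser, the
    transfer argument says that p does not divide the order of the derived subgroup, a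
    contradiction. *)
Lemma abelian_orderP (gT : finGroupType) (G : {group gT}) :
  abelian_order #|G| -> abelian G.
Proof.
move=> /allP abG; apply/derG1P/eqP; rewrite trivg_card1.
apply: contraT; rewrite neq_ltn ltnNge cardG_gt0 => /pdivP[p p_pr dvp].
have dvpG : p %| #|G| := dvdn_trans dvp (cardSg (der_sub 1 G)).
have piG r : prime r -> r %| #|G| -> r \in primes #|G|.
  by move=> r_pr dvr; rewrite mem_primes r_pr cardG_gt0.
have /andP[le2 /allP abp] := abG p (piG p p_pr dvpG).
have [P sylP] := Sylow_exists p G.
have [sPG pP _] := and3P sylP.
have oP : #|P| = (p ^ logn p #|G|)%N by rewrite (card_Hall sylP) p_part.
have cPP : abelian P by apply: (p2group_abelian pP); rewrite oP pfactorK.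
suffices cNP : 'N_G(P) \subset 'C(P).
  have /pgroupP/(_ p p_pr dvp) := der1_p'group_cent_norm sylP cPP cNP.
  by rewrite !inE eqxx.
(* The normaliser is generated by its Sylow subgroups, so each of them can be treated separately, as
   a q-group acting on [P]. *)
rewrite -(Sylow_gen [group of 'N_G(P)]) gen_subG; apply/bigcupsP=> A.
case/SylowP=> q q_pr sylA; have [sAN qA _] := and3P sylA.
have [sAG nPA] := subsetIP sAN.
(* The numerical hypothesis concerns only primes q that divide the order of [G]; a non-trivial [A]
   guarantees this. *)
have [->|ntA] := eqVneq (A : {set gT}) 1; first exact: sub1G.
have [def_q | p'q] := eqVneq p q.
  (* For q = p, the normal Sylow subgroup [P] of the normaliser contains [A], and [P] is abelian. *)
  have sylPN : q.-Sylow('N_G(P)) P.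
    by rewrite -def_q (pHall_subl _ (subsetIl _ _) sylP) // subsetI sPG normG.
  by apply: subset_trans cPP; rewrite (sub_normal_Hall sylPN) ?normalSG.
apply: (pgroup_cent_small p_pr q_pr p'q oP le2 _ qA nPA).
apply/abp/piG => //; apply: dvdn_trans (cardSg sAG).
by have [] := pgroup_pdiv qA ntA.
Qed.

(** * Sequencings tested on integer codes *)

Lemma of_nat_modn a m :
  N.of_nat (a %% m.+1) = (N.of_nat a mod N.of_nat m.+1)%num.
Proof.
apply: (N.mod_unique _ _ (N.of_nat (a %/ m.+1))).
  by have := ltn_pmod a (ltn0Sn m); lia.
by have := divn_eq a m.+1; lia.
Qed.

Lemma of_nat_expn a m :
  N.of_nat (a ^ m) = (N.of_nat a ^ N.of_nat m)%num.
Proof.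
elim: m => [|m IHm] //.
by rewrite expnS Nat2N.inj_succ N.pow_succ_r' -IHm; lia.
Qed.

(** Left translation preserves the quotients, so an arrangement may start at 1, and it is then
    recovered from its quotients as their partial products. Counting the initial 1, there are as
    many partial products as elements of the group, so distinctness alone makes them an
    arrangement. *)
Lemma sequenceable_products (gT : finGroupType) (b : seq gT) :
    size b = #|gT|.-1 -> uniq b -> uniq (1 :: scanl mulg 1 b) ->
  sequenceable gT.
Proof.
move=> szb Ub Us; set s := _ :: _ in Us.
have szs : size s = #|gT|.
  by rewrite /= size_scanl szb prednK //; apply/card_gt0P; exists 1.
(* [scanl] omits its starting value, which the leading 1 of [s] restores: entry i of [s] is the
   product of the first i terms of [b], the empty product for i = 0 included. *)
have nth_s i : i <= size b -> nth 1 s i = foldl mulg 1 (take i b).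
  by case: i => [|i] lt_ib; rewrite ?take0 //= nth_scanl.
exists s; split.
  apply: uniq_perm; rewrite ?enum_uniq //.
  have ss : {subset s <= enum gT} by move=> x _; rewrite mem_enum.
  by have [|_] := uniq_min_size Us ss; rewrite ?szs -?cardE.
suffices -> : quotients_seq s = b by [].
apply: (@eq_from_nth _ 1); rewrite size_map size_iota szs // => i lt_i.
rewrite (nth_map 0) ?nth_iota ?size_iota ?szs // add0n.
rewrite -szb in lt_i; rewrite (nth_s i.+1) // (nth_s i) 1?ltnW // (take_nth 1) //.
rewrite foldl_rcons; exact: mulKg.
Qed.

(** Sorting and then comparing neighbours avoids the quadratic number of comparisons made by [uniq];
    the lists have up to 555 entries. *)
Definition distinct (s : seq N) := sorted N.ltb (sort N.leb s).

Lemma distinct_uniq (s : seq N) : distinct s -> uniq s.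
Proof.
move/sorted_uniq; rewrite sort_uniq; apply; first by move=> x y z; lia.
by move=> x; lia.
Qed.

(* The integer 0 must encode the identity: products start from it. *)
Definition sequencing_code (mulN : N -> N -> N) (n : nat) (b : seq N) :=
  [&& size b == n.-1, all (fun c => N.ltb c (N.of_nat n)) b, distinct b
    & distinct (N0 :: scanl mulN N0 b)].

(** The decoded sequence works: [enc] turns its terms and partial products into those computed on
    codes, and elements with distinct images are distinct. For this [dec] only has to be a right
    inverse of [enc] on the integers below the order of the group. *)
Lemma sequenceable_code (gT : finGroupType) (enc : gT -> N) (dec : N -> gT)
    (mulN : N -> N -> N) (b : seq N) :
    enc 1 = N0 -> {morph enc : x y / x * y >-> mulN x y} ->
    (forall c, N.ltb c (N.of_nat #|gT|) -> enc (dec c) = c) ->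
  sequencing_code mulN #|gT| b -> sequenceable gT.
Proof.
move=> enc1 encM decK /and4P[/eqP szb /allP ltb /distinct_uniq Ub /distinct_uniq Us].
(* The range test in [sequencing_code] is what allows each entry to be decoded faithfully. *)
have decKb : map enc (map dec b) = b.
  by rewrite -map_comp map_id_in // => c /ltb /decK.
apply: (@sequenceable_products _ (map dec b)).
- by rewrite size_map.
- by apply: (@map_uniq _ _ enc); rewrite decKb.
have scanl_enc x s : map enc (scanl mulg x s) = scanl mulN (enc x) (map enc s).
  by elim: s x => //= y s IHs x; rewrite -encM IHs.
by apply: (@map_uniq _ _ enc); rewrite map_cons scanl_enc decKb enc1.
Qed.

(** * Semidirect products by a cyclic group *)

(** The proofs [phiD] and [phiK] are parameters of the type, so that the group structure declared on
    it can be inferred from the type alone. The generator of the cyclic group of order [k.+1] acts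
    as [phi], which [phiK] makes bijective; the order of [phi] may be a proper divisor of [k.+1]. *)
Definition semidirect (V : finZmodType) (phi : V -> V)
    (phiD : {morph phi : x y / (x + y)%R}) (k : nat)
    (phiK : iter k.+1 phi =1 id) : predArgType :=
  (V * 'I_k.+1)%type.

Section Semidirect.

Variables (V : finZmodType) (phi : V -> V).
Hypothesis phiD : {morph phi : x y / (x + y)%R}.
Variable k : nat.
Hypothesis phiK : iter k.+1 phi =1 id.

Local Notation gT := (semidirect phiD phiK).

HB.instance Definition _ := Finite.on gT.

Definition semidirect_one : gT := (0, 0)%R.
Definition semidirect_mul (x y : gT) : gT :=
  (x.1 + iter x.2 phi y.1, x.2 + y.2)%R.
(** The opposite [- x.2] is taken modulo [k.+1], so a negative power of [phi] becomes an ordinary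
    iterate. In the product of the inverse by [x], the two summands of the first component are
    opposite by construction. *)
Definition semidirect_inv (x : gT) : gT :=
  (- iter (- x.2)%R phi x.1, - x.2)%R.

Lemma iter_additive i : {morph iter i phi : x y / (x + y)%R}.
Proof. by move=> x y; elim: i => //= i ->. Qed.

(** Exponents are added in ['I_k.+1], hence reduced modulo [k.+1]; associativity needs the iterates
    of [phi] to be insensitive to this reduction. *)
Lemma iter_modn i : iter (i %% k.+1) phi =1 iter i phi.
Proof.
move=> x; rewrite {2}(divn_eq i k.+1) addnC iterD; congr (iter _ _ _).
by elim: (i %/ k.+1) => // j IHj; rewrite mulSn iterD phiK.
Qed.

Lemma semidirect_mulA : associative semidirect_mul.
Proof.
move=> x y z; rewrite /semidirect_mul /= iter_additive iter_modn iterD.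
by rewrite !addrA.
Qed.

Lemma semidirect_mul1 : left_id semidirect_one semidirect_mul.
Proof. by case=> v i; rewrite /semidirect_mul /= !add0r. Qed.

Lemma semidirect_mulV :
  left_inverse semidirect_one semidirect_inv semidirect_mul.
Proof. by move=> x; rewrite /semidirect_mul /= !addNr. Qed.

HB.instance Definition _ := Finite_isGroup.Build gT
  semidirect_mulA semidirect_mul1 semidirect_mulV.

Lemma card_semidirect : #|gT| = (#|V| * k.+1)%N.
Proof. by rewrite card_prod card_ord. Qed.

Variables (enc : V -> N) (dec : N -> V) (addN : N -> N -> N) (phiN : N -> N).
Hypothesis enc0 : enc 0%R = N0.
Hypothesis encD : {morph enc : x y / (x + y)%R >-> addN x y}.
Hypothesis encphi : {morph enc : x / phi x >-> phiN x}.
Hypothesis decK : forall c, N.ltb c (N.of_nat #|V|) -> enc (dec c) = c.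

(* (v, i) is encoded as enc v * K + i, where K is the order of the acting group. *)
Definition semidirect_code (K c d : N) : N :=
  (addN (c / K) (N.iter (c mod K) phiN (d / K)) * K + (c + d) mod K)%num.

(** A code is a two-digit numeral in which the last digit, in base K, is the exponent and the
    quotient by K codes the component in [V]. Uniqueness of Euclidean division recovers both, so
    [semidirect_code] mirrors the group law on codes. *)
Lemma sequenceable_semidirect (b : seq N) :
  sequencing_code (semidirect_code (N.of_nat k.+1)) (#|V| * k.+1) b ->
  sequenceable gT.
Proof.
set K := N.of_nat k.+1 => okb.
pose encG (x : gT) := (enc x.1 * K + N.of_nat x.2)%num.
pose decG (c : N) : gT := (dec (c / K), inord (N.to_nat (c mod K))).
have encGq x : (encG x / K)%num = enc x.1.
  apply/esym; apply: (N.div_unique _ _ _ (N.of_nat x.2)); last by rewrite /encG; lia.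
  by have := ltn_ord x.2; rewrite /K; lia.
have encGr x : (encG x mod K)%num = N.of_nat x.2.
  apply/esym; apply: (N.mod_unique _ _ (enc x.1)); last by rewrite /encG; lia.
  by have := ltn_ord x.2; rewrite /K; lia.
apply: (@sequenceable_code _ encG decG (semidirect_code K) b).
- by rewrite /encG /= enc0.
(* The code adds c and d whole before reducing modulo K; the multiples of K that carry the
   components in [V] disappear in the reduction. *)
- move=> x y; rewrite /semidirect_code encGq encGr N.add_mod ?encGr //.
  rewrite {1}/encG /= encD encGq; congr (addN _ _ * _ + _)%num.
    (* The binary iteration count is turned back into a natural number, and [enc] is pushed through
       the iterates one application at a time. *)
    rewrite N2Nat.inj_iter Nat2N.id; elim: (nat_of_ord x.2) => //= i <-.
    exact: encphi.
  rewrite -[X in N.of_nat X]/((x.2 + y.2) %% k.+1)%N of_nat_modn.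
  by rewrite Nat2N.inj_add.
- move=> c; rewrite card_semidirect => ltc; rewrite /encG /=.
  have ltr := N.mod_lt c K; rewrite inordK; last by rewrite /K in ltr *; lia.
  (* A code below the order of the group has a quotient by K below the order of [V], which is the
     domain of [decK]. *)
  rewrite decK; last by apply/N.ltb_spec0/N.div_lt_upper_bound; rewrite /K; lia.
  by rewrite N2Nat.id [RHS](N.div_mod c K) //; lia.
by rewrite card_semidirect.
Qed.

End Semidirect.

(** * Normal subgroups Z_m and Z_m^2 *)

Definition cyclic_addN (M c d : N) : N := ((c + d) mod M)%num.
Definition cyclic_phiN (M R c : N) : N := ((R * c) mod M)%num.

(** The congruence on r says that the k-th iterate of multiplication by r on Z_m is the identity,
    which is what [semidirect] asks of an action of Z_k; in particular r is a unit modulo m. Each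
    residue is its own code. *)
Lemma sequenceable_metacyclic (m k r : nat) (b : seq N) :
    0 < m -> 0 < k -> r ^ k = 1 %[mod m] ->
    let M := N.of_nat m in
    sequencing_code (semidirect_code (cyclic_addN M) (cyclic_phiN M (N.of_nat r))
      (N.of_nat k)) (m * k) b ->
  exists gT : finGroupType, #|gT| = (m * k)%N /\ sequenceable gT.
Proof.
case: m k => [//|m] [//|k] _ _ rk1 M okb.
(* Multiplication by r is written as a natural multiple: this uses only the additive group, and
   additivity is then distributivity of multiples. *)
pose phi (x : 'I_m.+1) := (x *+ r)%R.
have phiD : {morph phi : x y / (x + y)%R} by move=> x y; apply: mulrnDl.
have phiK : iter k.+1 phi =1 id.
  have iterE i x : iter i phi x = (x *+ (r ^ i))%R.
    by elim: i => //= i ->; rewrite /phi -mulrnA expnSr.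
  move=> x; rewrite iterE Zp_mulrn; apply: val_inj => /=.
  by rewrite -modnMmr rk1 modnMmr muln1 modn_small.
exists (semidirect phiD phiK); split; first by rewrite card_semidirect card_ord.
apply: (@sequenceable_semidirect _ _ phiD _ phiK (fun x => N.of_nat x)
  (fun c => inord (N.to_nat c)) (cyclic_addN M) (cyclic_phiN M (N.of_nat r))
  _ _ _ _ b).
- by [].
- by move=> x y; rewrite /cyclic_addN of_nat_modn Nat2N.inj_add.
- move=> x; rewrite /phi Zp_mulrn /cyclic_phiN of_nat_modn.
  by congr (_ mod _)%num; lia.
- by move=> c; rewrite card_ord => ltc; rewrite inordK; lia.
by rewrite card_ord.
Qed.

(** This joins the additive and the finite structure of a product, so that the product can serve as
    the normal subgroup of [semidirect]. *)
HB.instance Definition _ (U W : finZmodType) := GRing.Zmodule.on (U * W)%type.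

(* (x, y) is encoded as x * M + y, and the generator of the acting group maps it
   to (- y, x - y), which is multiplication by a cube root of unity. *)
Definition square_addN (M c d : N) : N :=
  (((c / M + d / M) mod M) * M + (c + d) mod M)%num.
Definition square_phiN (M c : N) : N :=
  (((M - c mod M) mod M) * M + (c / M + (M - c mod M)) mod M)%num.

(** With (x, y) read as x + y w, where w^2 + w + 1 = 0, multiplication by w sends it to - y + (x -
    y) w. Since w^3 = 1 over every Z_m, this is an action of Z_k as soon as 3 divides k. It is used
    for m = 5 and m = 11, where Z_m contains no cube root of unity other than 1; for k = 9 the
    action factors through Z_3. *)
Lemma sequenceable_square (m k : nat) (b : seq N) :
    0 < m -> 0 < k -> 3 %| k ->
    let M := N.of_nat m in
    sequencing_code (semidirect_code (square_addN M) (square_phiN M)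
      (N.of_nat k)) (m * m * k) b ->
  exists gT : finGroupType, #|gT| = (m * m * k)%N /\ sequenceable gT.
Proof.
case: m k => [//|m] [//|k] _ _ k3 M okb.
pose V : finZmodType := ('I_m.+1 * 'I_m.+1)%type.
pose phi (x : V) : V := (- x.2, x.1 - x.2)%R.
have phiD : {morph phi : x y / (x + y)%R}.
  by move=> x y; rewrite /phi /= !opprD addrACA.
have phiK : iter k.+1 phi =1 id.
  (* The successive images of (x, y) are (- y, x - y), (y - x, - x) and (x, y). *)
  have phi3 x : iter 3 phi x = x.
    by case: x => x y; rewrite /phi /= opprB addKr !opprK subrK.
  move=> x; have /dvdnP[j ->] := k3.
  by elim: j => // j IHj; rewrite mulSn iterD IHj phi3.
pose enc (x : V) := (N.of_nat x.1 * M + N.of_nat x.2)%num.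
have encq x : (enc x / M)%num = N.of_nat x.1.
  apply/esym; apply: (N.div_unique _ _ _ (N.of_nat x.2)); last by rewrite /enc; lia.
  by have := ltn_ord x.2; rewrite /M; lia.
have encr x : (enc x mod M)%num = N.of_nat x.2.
  apply/esym; apply: (N.mod_unique _ _ (N.of_nat x.1)); last by rewrite /enc; lia.
  by have := ltn_ord x.2; rewrite /M; lia.
exists (semidirect phiD phiK); split.
  by rewrite card_semidirect card_prod !card_ord.
apply: (@sequenceable_semidirect _ _ phiD _ phiK enc
  (fun c => (inord (N.to_nat (c / M)), inord (N.to_nat (c mod M))))
  (square_addN M) (square_phiN M) _ _ _ _ b).
- by [].
(* The second digit is computed from c + d directly, since the first digits contribute multiples of
   M. *)
- move=> x y; rewrite /square_addN !encq (N.add_mod (enc x)) // !encr.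
  by rewrite -!Nat2N.inj_add -!of_nat_modn.
- move=> x; rewrite /square_phiN !encq !encr.
  rewrite -Nat2N.inj_sub -!Nat2N.inj_add -!of_nat_modn /enc /=.
  (* In [square_phiN] the opposite of y is M - y, which is M rather than 0 when y = 0. The first
     digit reduces it modulo M at once; the second reduces only after adding x, unlike the sum in
     ['I_m.+1]. *)
  by rewrite modnDmr.
- move=> c; rewrite card_prod card_ord => ltc; rewrite /enc /=.
  have ltr := N.mod_lt c M; have ltq : (c / M < M)%num.
    by apply: N.div_lt_upper_bound; rewrite /M; lia.
  rewrite !inordK; last 2 first.
  + by rewrite /M in ltr *; lia.
  + by rewrite /M in ltq *; lia.
  by rewrite !N2Nat.id [RHS](N.div_mod c M) //; lia.
by rewrite card_prod card_ord.
Qed.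

(** * Boolean tests and the tables of sequencings *)

(** The congruence on r is tested in binary: powers such as 20^7, for the group of order 497, are
    out of reach of unary arithmetic. Its right-hand side is [1 mod M], the form taken by a
    congruence of natural numbers after transfer to [N]. *)
Definition metacyclic_check (e : nat * nat * nat * seq N) :=
  let: (m, k, r, b) := e in
  let: (M, K, R) := (N.of_nat m, N.of_nat k, N.of_nat r) in
  [&& 0 < m, 0 < k, N.eqb ((R ^ K) mod M) (1 mod M)
    & sequencing_code (semidirect_code (cyclic_addN M) (cyclic_phiN M R) K) (m * k) b].

Lemma metacyclic_checkP m k r b :
    metacyclic_check (m, k, r, b) ->
  exists gT : finGroupType, #|gT| = (m * k)%N /\ sequenceable gT.
Proof.
case/and4P=> m_gt0 k_gt0 /N.eqb_spec rk1 okb.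
apply: (sequenceable_metacyclic m_gt0 k_gt0 _ okb).
(* Both sides become images of natural numbers, and injectivity of the embedding into [N] gives the
   congruence back. *)
case: m m_gt0 rk1 {okb} => // m _; rewrite -of_nat_expn -(of_nat_modn 1).
by rewrite -of_nat_modn => /Nat2N.inj.
Qed.

(** No congruence has to be tested here: the automorphism is fixed and has trivial cube, so
    divisibility of k by 3 takes its place. *)
Definition square_check (e : nat * nat * seq N) :=
  let: (m, k, b) := e in
  let: (M, K) := (N.of_nat m, N.of_nat k) in
  [&& 0 < m, 0 < k, 3 %| k
    & sequencing_code (semidirect_code (square_addN M) (square_phiN M) K)
        (m * m * k) b].

(* (m, k, r, b): the sequencing b of the group Z_m : Z_k in which the generator of
   Z_k acts on Z_m as multiplication by r, each entry c standing for (c / k, c mod k).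
   The sequences were found by randomised local search. *)
Definition metacyclic_sequencings : seq (nat * nat * nat * seq N) := [::
  (7, 3, 2, [::
18; 19; 6; 17; 16; 14; 5; 10; 4; 7; 11; 1; 3; 15; 9; 13; 8; 20; 12; 2]%num);
  (9, 3, 4, [::
17; 3; 2; 10; 25; 26; 21; 5; 7; 24; 22; 14; 20; 23; 19; 1; 4; 12; 16; 9; 8; 13; 15; 18;
11; 6]%num);
  (13, 3, 3, [::
16; 5; 35; 18; 25; 28; 9; 4; 31; 13; 1; 37; 30; 15; 36; 8; 33; 26; 27; 22; 3; 29; 34; 21;
24; 2; 11; 12; 10; 32; 7; 19; 23; 6; 14; 17; 20; 38]%num);
  (11, 5, 3, [::
31; 42; 28; 35; 53; 13; 8; 40; 17; 2; 51; 18; 9; 15; 54; 32; 36; 21; 1; 46; 49; 23; 6; 52;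
22; 12; 50; 4; 26; 48; 30; 3; 24; 39; 29; 33; 11; 41; 14; 27; 38; 25; 19; 20; 37; 47; 7;
16; 44; 10; 5; 34; 43; 45]%num);
  (19, 3, 7, [::
44; 8; 48; 26; 13; 9; 1; 7; 29; 16; 43; 18; 22; 11; 35; 46; 23; 39; 5; 6; 14; 20; 47; 25;
41; 42; 10; 56; 2; 31; 28; 55; 24; 15; 36; 49; 12; 50; 54; 38; 51; 17; 21; 32; 40; 19; 34;
37; 27; 3; 4; 33; 52; 53; 45; 30]%num);
  (21, 3, 4, [::
49; 18; 19; 24; 52; 44; 55; 14; 38; 25; 2; 45; 29; 10; 8; 35; 61; 3; 1; 12; 4; 21; 53; 47;
33; 60; 57; 27; 39; 32; 46; 28; 41; 30; 43; 7; 54; 59; 9; 13; 5; 58; 20; 22; 51; 11; 36;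
17; 16; 34; 62; 40; 26; 56; 23; 48; 50; 31; 15; 37; 6; 42]%num);
  (27, 3, 10, [::
5; 48; 6; 21; 47; 26; 18; 9; 41; 29; 65; 17; 38; 20; 72; 4; 49; 32; 59; 34; 73; 42; 31;
39; 68; 19; 11; 25; 16; 28; 14; 24; 22; 7; 67; 53; 60; 36; 44; 23; 30; 70; 2; 80; 61; 62;
37; 27; 75; 46; 78; 56; 1; 43; 40; 52; 76; 79; 33; 77; 45; 35; 57; 3; 54; 10; 71; 15; 8;
69; 66; 51; 63; 74; 12; 55; 58; 64; 50; 13]%num);
  (31, 3, 5, [::
19; 83; 49; 79; 77; 20; 59; 29; 86; 24; 38; 71; 84; 73; 28; 26; 91; 75; 61; 21; 85; 69; 1;
56; 4; 22; 47; 52; 90; 10; 81; 54; 63; 37; 66; 9; 12; 8; 36; 60; 17; 62; 44; 68; 11; 46;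
18; 43; 6; 35; 76; 89; 34; 92; 64; 5; 13; 65; 30; 55; 3; 70; 87; 14; 74; 53; 27; 80; 31;
23; 7; 45; 88; 41; 57; 2; 40; 78; 82; 15; 48; 50; 58; 39; 72; 67; 32; 33; 16; 51; 25; 42]%num);
  (35, 3, 11, [::
78; 76; 102; 99; 35; 55; 32; 17; 14; 28; 25; 20; 8; 9; 57; 70; 65; 22; 61; 3; 33; 6; 15;
19; 80; 41; 27; 7; 54; 39; 100; 85; 101; 56; 97; 2; 12; 71; 87; 59; 11; 91; 103; 21; 45;
16; 34; 49; 73; 58; 64; 18; 81; 29; 4; 63; 69; 52; 82; 77; 46; 60; 67; 43; 79; 74; 30; 89;
62; 51; 37; 53; 23; 68; 26; 10; 50; 84; 48; 75; 31; 36; 83; 98; 5; 47; 95; 86; 13; 104;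
44; 1; 40; 24; 66; 96; 92; 90; 72; 42; 88; 94; 93; 38]%num);
  (37, 3, 10, [::
33; 37; 51; 45; 59; 73; 4; 44; 39; 60; 70; 68; 11; 21; 28; 101; 24; 80; 2; 47; 7; 97; 88;
110; 23; 87; 6; 109; 10; 55; 85; 104; 49; 67; 26; 54; 20; 40; 77; 79; 69; 53; 30; 42; 52;
41; 56; 96; 50; 63; 62; 27; 95; 91; 8; 84; 48; 57; 43; 36; 98; 106; 17; 15; 29; 3; 90; 12;
14; 100; 5; 19; 22; 82; 78; 89; 25; 92; 102; 65; 66; 1; 18; 72; 94; 103; 76; 58; 46; 9;
108; 38; 81; 35; 74; 93; 34; 107; 16; 71; 105; 31; 99; 32; 75; 13; 86; 61; 83; 64]%num);
  (39, 3, 16, [::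
86; 112; 30; 85; 108; 19; 91; 61; 17; 41; 36; 15; 56; 64; 111; 40; 110; 16; 74; 105; 27;
57; 107; 106; 62; 11; 53; 20; 82; 47; 31; 65; 102; 94; 116; 84; 89; 2; 79; 75; 77; 51;
104; 9; 34; 52; 44; 67; 69; 24; 109; 58; 92; 78; 93; 97; 100; 83; 87; 43; 98; 6; 35; 3;
26; 28; 23; 14; 25; 55; 59; 7; 13; 1; 80; 66; 49; 81; 45; 95; 5; 22; 50; 54; 88; 113; 29;
103; 114; 46; 68; 38; 99; 8; 4; 39; 72; 12; 76; 18; 96; 90; 71; 48; 10; 42; 33; 21; 101;
63; 60; 32; 115; 37; 70; 73]%num);
  (25, 5, 6, [::
1; 91; 44; 101; 104; 29; 107; 7; 83; 100; 113; 34; 39; 111; 95; 15; 49; 92; 6; 21; 13; 50;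
88; 75; 58; 36; 51; 30; 54; 20; 117; 40; 60; 84; 81; 63; 86; 55; 109; 19; 78; 72; 119; 87;
45; 105; 14; 82; 94; 38; 64; 68; 85; 108; 106; 120; 57; 5; 56; 28; 103; 3; 35; 62; 77;
116; 97; 110; 80; 61; 93; 32; 24; 26; 2; 10; 121; 11; 115; 33; 4; 73; 67; 69; 118; 71; 79;
70; 12; 52; 90; 18; 65; 42; 96; 76; 37; 122; 47; 17; 8; 46; 102; 27; 23; 31; 74; 112; 89;
124; 9; 25; 48; 53; 22; 59; 66; 99; 41; 43; 123; 16; 114; 98]%num);
  (43, 3, 6, [::
77; 119; 85; 52; 110; 104; 50; 78; 97; 73; 34; 23; 12; 80; 7; 64; 113; 30; 82; 108; 54;
46; 62; 14; 60; 95; 28; 61; 67; 125; 42; 71; 37; 105; 56; 29; 90; 122; 86; 45; 39; 112;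
96; 25; 103; 19; 126; 8; 48; 99; 40; 38; 21; 91; 41; 101; 55; 107; 11; 9; 33; 92; 72; 26;
123; 84; 65; 57; 117; 102; 75; 22; 111; 36; 53; 121; 69; 27; 109; 10; 79; 1; 89; 70; 115;
59; 120; 83; 24; 35; 76; 98; 51; 16; 106; 74; 4; 20; 68; 93; 100; 63; 49; 66; 18; 116; 81;
87; 17; 114; 124; 118; 94; 31; 58; 2; 127; 44; 6; 15; 88; 5; 43; 32; 3; 47; 128; 13]%num);
  (45, 3, 16, [::
54; 16; 88; 111; 42; 106; 52; 104; 61; 38; 49; 37; 97; 108; 67; 57; 80; 22; 128; 55; 14;
47; 66; 24; 102; 19; 53; 77; 119; 85; 75; 100; 114; 35; 94; 101; 129; 126; 134; 13; 17;
44; 117; 21; 125; 43; 29; 98; 79; 122; 90; 20; 65; 9; 59; 124; 87; 36; 28; 63; 71; 70; 73;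
89; 103; 23; 72; 39; 1; 62; 99; 4; 30; 132; 31; 96; 107; 18; 2; 82; 51; 58; 45; 133; 69;
40; 48; 113; 86; 10; 83; 25; 46; 130; 112; 92; 120; 95; 91; 34; 3; 115; 15; 7; 32; 127;
110; 116; 76; 121; 26; 81; 12; 5; 6; 123; 33; 27; 8; 78; 93; 64; 118; 109; 41; 131; 60;
56; 74; 50; 11; 84; 68; 105]%num);
  (49, 3, 18, [::
28; 133; 74; 132; 101; 38; 130; 134; 89; 30; 65; 105; 57; 145; 95; 109; 6; 111; 84; 137;
104; 107; 67; 7; 18; 36; 8; 112; 120; 40; 72; 27; 142; 116; 73; 44; 55; 75; 78; 98; 4; 77;
110; 39; 25; 54; 141; 49; 71; 125; 32; 17; 61; 50; 115; 143; 91; 24; 138; 96; 42; 20; 16;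
63; 48; 64; 86; 15; 60; 106; 144; 66; 37; 3; 102; 33; 100; 53; 108; 124; 14; 123; 122; 31;
43; 1; 69; 29; 22; 23; 97; 127; 85; 92; 103; 87; 9; 136; 146; 76; 19; 80; 26; 121; 13;
131; 81; 2; 47; 93; 70; 11; 140; 46; 119; 51; 114; 90; 128; 62; 68; 5; 117; 139; 99; 52;
58; 113; 35; 83; 135; 82; 88; 126; 56; 21; 12; 45; 41; 94; 59; 79; 129; 34; 118; 10]%num);
  (31, 5, 2, [::
136; 35; 142; 81; 79; 122; 48; 152; 30; 20; 14; 62; 119; 23; 1; 6; 137; 73; 100; 125; 87;
131; 43; 28; 72; 33; 60; 24; 90; 25; 51; 66; 143; 64; 151; 129; 36; 78; 126; 69; 5; 144;
76; 7; 32; 146; 27; 42; 40; 112; 84; 103; 21; 130; 107; 12; 97; 68; 132; 63; 113; 15; 114;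
94; 102; 65; 75; 98; 138; 141; 110; 10; 85; 46; 99; 117; 140; 55; 82; 127; 57; 96; 80; 89;
95; 29; 88; 147; 123; 139; 149; 135; 44; 101; 116; 128; 4; 18; 118; 54; 38; 56; 86; 16;
153; 39; 22; 154; 37; 93; 17; 92; 150; 77; 111; 26; 134; 106; 67; 8; 19; 124; 13; 34; 115;
47; 2; 49; 83; 71; 45; 109; 59; 41; 108; 52; 74; 70; 91; 11; 58; 120; 3; 61; 53; 105; 133;
145; 50; 148; 9; 104; 31; 121]%num);
  (33, 5, 4, [::
53; 56; 90; 52; 94; 82; 93; 150; 118; 51; 45; 111; 58; 129; 147; 89; 60; 108; 135; 123;
106; 26; 19; 148; 74; 98; 130; 41; 6; 140; 131; 23; 30; 24; 32; 69; 87; 15; 12; 43; 28;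
21; 68; 49; 112; 70; 151; 146; 125; 84; 120; 29; 109; 122; 35; 133; 143; 48; 36; 17; 37;
92; 127; 164; 76; 160; 1; 158; 86; 124; 34; 99; 42; 72; 61; 110; 8; 75; 102; 97; 2; 20;
16; 57; 107; 65; 79; 149; 63; 11; 27; 73; 116; 22; 96; 67; 114; 141; 138; 38; 139; 47; 81;
157; 103; 159; 153; 7; 44; 3; 145; 156; 50; 83; 137; 115; 134; 136; 113; 161; 71; 163;
101; 91; 95; 121; 80; 10; 104; 119; 54; 152; 88; 162; 85; 4; 9; 14; 62; 40; 117; 66; 46;
128; 78; 155; 59; 144; 64; 31; 5; 55; 25; 132; 142; 126; 77; 154; 105; 18; 13; 100; 33; 39]%num);
  (57, 3, 7, [::
98; 141; 88; 11; 169; 73; 74; 52; 83; 103; 19; 142; 23; 152; 66; 17; 151; 134; 149; 147;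
30; 58; 121; 76; 118; 168; 32; 109; 132; 95; 29; 112; 133; 14; 91; 36; 114; 40; 124; 136;
71; 54; 155; 99; 160; 156; 137; 116; 46; 45; 34; 164; 6; 60; 166; 5; 4; 63; 70; 64; 106;
138; 85; 94; 117; 125; 170; 49; 131; 89; 53; 81; 148; 62; 158; 25; 57; 18; 61; 161; 80;
128; 111; 7; 31; 100; 68; 140; 28; 21; 144; 96; 72; 104; 167; 69; 146; 13; 107; 59; 123;
135; 143; 78; 48; 110; 113; 44; 37; 20; 16; 92; 162; 51; 10; 47; 65; 150; 157; 3; 130; 35;
38; 42; 8; 67; 56; 1; 41; 43; 129; 153; 86; 105; 77; 9; 90; 108; 84; 27; 127; 55; 120;
139; 82; 50; 165; 126; 102; 122; 145; 115; 154; 26; 101; 93; 79; 24; 87; 75; 33; 159; 119;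
163; 15; 97; 39; 2; 22; 12]%num);
  (61, 3, 13, [::
120; 124; 177; 25; 78; 65; 4; 148; 51; 70; 41; 135; 163; 83; 59; 138; 60; 49; 11; 147; 10;
90; 16; 127; 108; 129; 46; 37; 165; 23; 166; 54; 74; 43; 15; 69; 42; 26; 115; 22; 144; 62;
98; 18; 139; 182; 125; 31; 68; 149; 116; 100; 130; 118; 114; 174; 103; 143; 77; 47; 110;
87; 20; 126; 56; 6; 180; 178; 7; 107; 172; 14; 5; 117; 33; 85; 158; 48; 61; 72; 105; 176;
12; 173; 24; 2; 28; 80; 81; 136; 9; 142; 30; 96; 155; 27; 132; 75; 156; 153; 93; 64; 151;
8; 161; 167; 17; 181; 164; 102; 94; 3; 152; 133; 67; 141; 82; 111; 150; 29; 179; 84; 55;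
66; 40; 154; 79; 53; 86; 39; 57; 123; 76; 99; 13; 34; 131; 88; 52; 92; 58; 112; 104; 21;
169; 122; 128; 146; 97; 73; 101; 119; 175; 160; 145; 137; 19; 63; 106; 44; 50; 71; 1; 36;
162; 113; 32; 35; 45; 157; 170; 159; 121; 168; 134; 140; 91; 95; 109; 171; 89; 38]%num);
  (63, 3, 4, [::
163; 91; 188; 135; 6; 59; 132; 167; 58; 134; 47; 84; 148; 170; 122; 78; 41; 166; 174; 154;
100; 130; 171; 5; 44; 160; 182; 177; 151; 72; 106; 14; 149; 107; 128; 8; 31; 4; 92; 46;
120; 172; 155; 33; 16; 57; 21; 147; 12; 140; 71; 179; 150; 10; 66; 90; 183; 81; 13; 139;
60; 86; 61; 95; 73; 29; 37; 129; 15; 1; 67; 109; 64; 45; 94; 105; 98; 146; 75; 159; 169;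
153; 125; 142; 103; 178; 121; 127; 38; 27; 187; 164; 141; 56; 143; 131; 93; 126; 32; 28;
25; 110; 35; 158; 76; 144; 24; 40; 101; 2; 85; 26; 136; 74; 68; 9; 145; 113; 11; 112; 117;
83; 22; 185; 176; 77; 3; 30; 116; 70; 162; 181; 156; 42; 89; 39; 118; 80; 124; 79; 20;
168; 43; 50; 157; 23; 108; 19; 114; 63; 51; 36; 165; 48; 115; 184; 99; 186; 7; 18; 175;
49; 111; 52; 65; 34; 53; 173; 152; 17; 104; 133; 87; 161; 54; 88; 137; 180; 119; 55; 82;
62; 102; 97; 123; 138; 96; 69]%num);
  (65, 3, 16, [::
30; 57; 179; 148; 119; 58; 114; 108; 118; 54; 168; 45; 88; 158; 184; 101; 176; 113; 180;
9; 149; 105; 156; 172; 186; 17; 80; 15; 181; 18; 194; 163; 131; 31; 69; 142; 35; 189; 74;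
99; 48; 53; 32; 82; 43; 182; 85; 21; 22; 162; 2; 70; 24; 106; 171; 6; 134; 166; 68; 150;
112; 121; 107; 167; 94; 28; 60; 192; 64; 96; 90; 61; 7; 128; 95; 102; 46; 143; 177; 141;
4; 27; 75; 151; 93; 77; 126; 109; 25; 78; 169; 42; 44; 155; 170; 137; 98; 120; 65; 116;
160; 154; 125; 63; 49; 132; 38; 76; 104; 71; 191; 183; 115; 40; 161; 23; 72; 62; 50; 185;
79; 20; 5; 123; 164; 86; 127; 1; 178; 165; 56; 139; 36; 110; 12; 153; 122; 144; 91; 188;
11; 117; 190; 147; 175; 135; 10; 124; 130; 55; 14; 174; 67; 33; 66; 59; 29; 145; 140; 52;
173; 41; 129; 47; 37; 159; 3; 152; 51; 34; 133; 39; 26; 92; 87; 89; 138; 146; 13; 187;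
100; 103; 84; 97; 8; 83; 157; 193; 136; 81; 16; 73; 111; 19]%num);
  (67, 3, 29, [::
174; 17; 16; 81; 50; 13; 132; 71; 133; 40; 150; 139; 64; 48; 70; 118; 84; 86; 15; 199;
182; 177; 74; 180; 99; 103; 107; 122; 24; 110; 124; 119; 30; 35; 136; 23; 106; 76; 190;
45; 91; 115; 63; 183; 9; 197; 173; 78; 131; 152; 187; 128; 120; 140; 153; 73; 178; 112;
52; 80; 198; 93; 7; 12; 165; 22; 102; 175; 151; 137; 164; 62; 168; 189; 98; 87; 191; 95;
85; 77; 171; 101; 144; 65; 21; 135; 42; 145; 41; 188; 60; 194; 36; 18; 155; 146; 53; 89;
92; 143; 39; 1; 90; 179; 26; 149; 154; 2; 109; 75; 129; 61; 27; 44; 25; 32; 46; 51; 141;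
184; 157; 105; 72; 193; 57; 104; 113; 185; 108; 169; 34; 116; 88; 123; 114; 33; 100; 111;
55; 159; 29; 66; 121; 117; 156; 10; 147; 138; 158; 186; 31; 192; 54; 166; 163; 96; 11; 67;
79; 8; 127; 47; 94; 170; 134; 58; 19; 148; 37; 160; 97; 43; 130; 195; 125; 162; 82; 200;
68; 49; 20; 56; 161; 196; 126; 83; 167; 172; 28; 4; 3; 6; 5; 176; 142; 38; 14; 59; 181; 69]%num);
  (29, 7, 7, [::
81; 98; 57; 30; 139; 75; 55; 155; 44; 154; 82; 119; 62; 175; 202; 84; 68; 191; 108; 80;
163; 20; 110; 64; 36; 179; 116; 31; 49; 122; 83; 150; 118; 187; 159; 102; 5; 19; 3; 142;
141; 40; 197; 192; 148; 21; 22; 34; 129; 104; 138; 48; 12; 37; 103; 33; 11; 170; 188; 97;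
16; 67; 10; 136; 45; 137; 190; 151; 26; 42; 53; 121; 117; 73; 120; 113; 65; 111; 46; 88;
38; 171; 23; 100; 17; 66; 200; 18; 174; 69; 4; 15; 52; 6; 164; 25; 168; 76; 86; 195; 74;
130; 184; 152; 72; 8; 125; 193; 54; 51; 92; 149; 9; 78; 14; 133; 160; 93; 143; 147; 165;
123; 182; 59; 196; 173; 127; 177; 109; 194; 70; 95; 39; 114; 167; 94; 112; 158; 134; 89;
101; 79; 35; 180; 124; 47; 166; 131; 146; 132; 41; 169; 58; 63; 135; 91; 126; 162; 185; 1;
201; 176; 71; 96; 105; 7; 161; 77; 27; 29; 87; 181; 2; 107; 153; 178; 186; 61; 50; 128;
115; 199; 85; 140; 13; 144; 56; 28; 24; 157; 156; 183; 99; 198; 172; 32; 43; 60; 90; 189;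
145; 106]%num);
  (41, 5, 10, [::
196; 123; 144; 188; 68; 60; 167; 70; 102; 145; 63; 192; 13; 35; 22; 37; 44; 92; 172; 201;
64; 14; 15; 180; 112; 143; 21; 202; 100; 72; 104; 110; 147; 124; 45; 24; 197; 181; 117;
132; 105; 62; 23; 42; 177; 76; 79; 19; 174; 86; 169; 17; 113; 8; 146; 26; 156; 61; 164;
107; 97; 194; 153; 186; 4; 7; 121; 65; 28; 150; 140; 99; 116; 5; 16; 85; 41; 131; 18; 118;
129; 33; 168; 101; 36; 122; 137; 39; 30; 82; 93; 58; 126; 119; 48; 182; 31; 195; 128; 40;
84; 78; 91; 75; 89; 114; 179; 163; 203; 96; 154; 25; 34; 49; 74; 160; 47; 198; 87; 171;
157; 50; 11; 162; 187; 108; 158; 199; 2; 109; 77; 95; 32; 111; 54; 190; 135; 73; 94; 10;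
115; 141; 59; 139; 69; 151; 183; 103; 159; 53; 204; 165; 189; 67; 155; 29; 149; 176; 184;
120; 133; 80; 38; 191; 125; 9; 200; 66; 55; 185; 193; 51; 178; 1; 136; 166; 12; 138; 127;
3; 83; 152; 71; 134; 142; 175; 56; 81; 90; 52; 170; 57; 130; 27; 161; 106; 43; 148; 46;
98; 6; 20; 173; 88]%num);
  (73, 3, 8, [::
93; 96; 9; 184; 53; 216; 177; 142; 178; 163; 218; 43; 107; 168; 164; 73; 15; 212; 161;
112; 57; 115; 119; 18; 105; 98; 166; 146; 8; 157; 36; 139; 63; 174; 198; 51; 213; 66; 3;
194; 24; 100; 196; 144; 127; 167; 10; 71; 187; 154; 123; 215; 97; 201; 56; 120; 101; 72;
209; 130; 82; 62; 160; 171; 78; 32; 50; 54; 173; 217; 44; 102; 16; 59; 176; 152; 22; 94;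
132; 108; 125; 55; 27; 141; 52; 39; 204; 162; 42; 85; 58; 145; 185; 95; 81; 79; 186; 69;
136; 91; 121; 195; 192; 181; 103; 126; 180; 31; 49; 47; 35; 207; 37; 188; 61; 155; 151;
92; 48; 143; 20; 6; 116; 128; 86; 190; 191; 75; 104; 12; 29; 114; 45; 65; 84; 110; 147;
14; 117; 99; 118; 38; 111; 124; 19; 203; 34; 106; 210; 30; 211; 109; 41; 165; 23; 159; 5;
179; 140; 77; 64; 17; 46; 199; 83; 74; 134; 2; 87; 172; 158; 205; 70; 175; 148; 60; 200;
133; 129; 135; 33; 183; 122; 28; 197; 80; 89; 90; 25; 206; 193; 26; 131; 4; 150; 137; 67;
153; 11; 169; 214; 149; 189; 88; 76; 13; 156; 113; 170; 7; 202; 21; 182; 68; 138; 40; 208;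
1]%num);
  (77, 3, 23, [::
208; 178; 26; 71; 198; 120; 32; 187; 107; 105; 157; 33; 221; 216; 21; 202; 163; 195; 141;
24; 230; 103; 104; 166; 153; 200; 152; 52; 127; 196; 10; 129; 61; 100; 35; 142; 75; 209;
136; 149; 99; 66; 193; 64; 95; 81; 94; 144; 188; 36; 68; 135; 214; 42; 48; 199; 5; 203;
90; 132; 210; 77; 96; 23; 131; 223; 150; 185; 47; 133; 145; 27; 179; 164; 30; 118; 12;
134; 14; 9; 56; 222; 91; 116; 124; 111; 11; 110; 140; 138; 16; 158; 92; 229; 180; 49; 44;
51; 31; 67; 59; 34; 176; 8; 87; 63; 86; 78; 38; 76; 122; 182; 206; 125; 108; 151; 130;
181; 2; 54; 186; 167; 15; 205; 184; 148; 117; 155; 218; 25; 146; 175; 143; 106; 84; 4;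
165; 225; 13; 207; 128; 169; 197; 173; 121; 139; 69; 19; 37; 171; 161; 93; 46; 194; 162;
183; 20; 204; 65; 217; 112; 126; 50; 213; 228; 224; 18; 215; 79; 226; 123; 212; 98; 159;
39; 62; 147; 58; 45; 177; 220; 192; 83; 191; 7; 219; 97; 29; 156; 160; 72; 211; 113; 190;
41; 89; 3; 168; 6; 137; 154; 17; 55; 22; 80; 74; 170; 28; 119; 174; 53; 88; 1; 109; 43;
114; 102; 227; 115; 82; 85; 57; 73; 40; 101; 189; 172; 70; 201; 60]%num);
  (79, 3, 23, [::
189; 222; 32; 97; 125; 9; 33; 40; 150; 205; 136; 83; 45; 141; 65; 85; 109; 64; 226; 144;
211; 3; 188; 133; 123; 38; 172; 179; 215; 185; 214; 167; 169; 11; 50; 155; 4; 137; 223;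
191; 31; 121; 212; 230; 232; 213; 82; 67; 166; 63; 89; 23; 164; 187; 103; 99; 102; 233;
177; 54; 58; 135; 59; 163; 100; 37; 66; 75; 145; 73; 7; 43; 34; 36; 115; 19; 84; 26; 29;
106; 114; 210; 197; 5; 221; 229; 28; 46; 27; 61; 235; 218; 57; 60; 41; 70; 178; 86; 93;
96; 147; 112; 193; 25; 53; 116; 30; 192; 225; 129; 142; 158; 110; 56; 196; 55; 122; 140;
22; 162; 94; 219; 120; 181; 170; 47; 126; 146; 156; 21; 224; 104; 119; 90; 138; 161; 154;
17; 20; 236; 35; 74; 198; 209; 18; 10; 51; 24; 202; 92; 15; 98; 14; 48; 207; 217; 69; 152;
62; 183; 195; 143; 107; 13; 44; 132; 76; 228; 201; 117; 68; 16; 227; 78; 153; 139; 194; 6;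
2; 175; 157; 131; 182; 80; 184; 71; 124; 199; 42; 49; 8; 148; 111; 1; 234; 176; 204; 151;
39; 203; 186; 159; 216; 206; 88; 180; 173; 113; 134; 101; 171; 231; 128; 190; 95; 87; 127;
12; 77; 72; 220; 208; 130; 105; 52; 200; 91; 149; 160; 168; 165; 174; 118; 79; 108; 81]%num);
  (81, 3, 28, [::
164; 94; 26; 128; 58; 137; 227; 180; 226; 43; 123; 29; 22; 138; 140; 232; 177; 91; 203;
146; 55; 124; 127; 3; 90; 149; 191; 120; 156; 158; 118; 215; 171; 108; 113; 110; 221; 71;
15; 119; 10; 220; 223; 68; 115; 187; 30; 208; 72; 241; 142; 148; 6; 192; 89; 214; 12; 193;
235; 172; 198; 99; 145; 178; 174; 211; 131; 125; 76; 169; 218; 182; 234; 64; 52; 83; 27;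
98; 34; 162; 16; 63; 206; 166; 37; 210; 216; 8; 133; 31; 60; 222; 239; 161; 117; 229; 59;
170; 7; 167; 230; 233; 48; 40; 50; 195; 151; 121; 212; 184; 81; 204; 9; 45; 135; 102; 197;
88; 205; 69; 97; 61; 103; 213; 2; 79; 75; 4; 163; 160; 106; 18; 19; 92; 201; 209; 196; 44;
130; 21; 73; 217; 33; 32; 105; 66; 80; 219; 82; 39; 159; 46; 168; 188; 136; 109; 24; 139;
224; 78; 154; 36; 143; 23; 231; 85; 126; 144; 47; 173; 141; 111; 181; 147; 240; 54; 185;
14; 51; 238; 190; 202; 87; 53; 38; 5; 70; 199; 122; 1; 112; 107; 242; 28; 236; 200; 35;
189; 62; 101; 228; 17; 86; 41; 104; 11; 96; 25; 207; 20; 134; 155; 93; 237; 100; 132; 183;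
186; 65; 77; 179; 114; 95; 225; 152; 176; 74; 67; 165; 42; 153; 49; 116; 175; 57; 194;
157; 56; 13; 150; 129; 84]%num);
  (23, 11, 2, [::
10; 152; 99; 94; 81; 79; 235; 3; 158; 181; 202; 209; 89; 125; 120; 106; 151; 29; 49; 44;
146; 52; 30; 221; 171; 130; 186; 194; 86; 115; 78; 109; 245; 217; 111; 56; 238; 142; 189;
58; 98; 244; 197; 67; 215; 143; 9; 239; 84; 140; 76; 247; 226; 251; 123; 50; 64; 241; 225;
31; 63; 173; 211; 219; 188; 19; 16; 73; 77; 127; 155; 82; 46; 234; 166; 116; 42; 199; 183;
240; 218; 164; 45; 133; 165; 93; 246; 48; 104; 208; 161; 148; 26; 129; 95; 40; 126; 35;
124; 131; 38; 118; 72; 66; 119; 191; 216; 180; 196; 170; 107; 41; 150; 37; 12; 224; 169;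
43; 174; 68; 114; 212; 13; 60; 145; 132; 85; 18; 220; 71; 147; 230; 122; 157; 25; 21; 141;
39; 20; 53; 182; 108; 172; 201; 190; 87; 55; 214; 177; 248; 83; 80; 47; 252; 28; 204; 33;
101; 92; 232; 128; 74; 162; 121; 249; 113; 192; 195; 57; 88; 2; 100; 134; 105; 138; 229;
96; 176; 144; 193; 207; 75; 34; 11; 231; 65; 27; 184; 135; 97; 185; 236; 187; 32; 160;
110; 23; 139; 15; 154; 62; 168; 210; 179; 7; 103; 250; 156; 54; 227; 243; 61; 36; 222;
198; 203; 159; 242; 59; 136; 213; 102; 1; 117; 205; 90; 14; 167; 4; 6; 91; 228; 24; 22; 8;
178; 153; 5; 223; 200; 17; 70; 237; 112; 69; 233; 51; 163; 175; 206; 137; 149]%num);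
  (91, 3, 9, [::
104; 264; 259; 219; 215; 15; 178; 187; 170; 176; 208; 4; 172; 152; 24; 159; 146; 36; 184;
84; 135; 204; 249; 167; 260; 129; 252; 169; 267; 226; 189; 113; 182; 180; 73; 229; 166;
177; 140; 8; 20; 9; 186; 121; 157; 261; 250; 163; 86; 205; 54; 179; 211; 99; 193; 213; 18;
183; 77; 233; 19; 256; 251; 57; 137; 216; 224; 115; 214; 139; 28; 26; 75; 209; 111; 132;
40; 191; 185; 230; 270; 81; 5; 266; 207; 221; 218; 94; 90; 93; 87; 79; 70; 123; 225; 238;
244; 97; 69; 154; 248; 227; 2; 155; 245; 61; 32; 237; 200; 192; 107; 50; 128; 41; 48; 149;
126; 91; 188; 223; 105; 190; 241; 114; 22; 151; 44; 1; 145; 52; 29; 37; 254; 16; 125; 72;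
181; 246; 95; 7; 21; 59; 148; 46; 64; 269; 78; 118; 175; 27; 117; 164; 42; 203; 144; 130;
156; 268; 272; 136; 201; 39; 11; 265; 255; 49; 202; 120; 194; 171; 88; 102; 17; 106; 101;
262; 127; 141; 6; 142; 174; 23; 231; 239; 161; 234; 222; 96; 124; 98; 196; 53; 138; 63;
92; 109; 199; 263; 236; 68; 210; 242; 76; 12; 212; 197; 100; 122; 220; 55; 232; 85; 240;
162; 247; 56; 217; 58; 3; 131; 173; 74; 257; 47; 195; 235; 168; 228; 147; 243; 271; 25;
160; 110; 158; 82; 253; 30; 206; 133; 65; 35; 80; 134; 103; 13; 71; 143; 108; 33; 34; 67;
38; 150; 43; 153; 112; 60; 258; 14; 66; 51; 31; 83; 45; 198; 119; 89; 10; 165; 116; 62]%num);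
  (55, 5, 16, [::
66; 26; 232; 48; 141; 194; 42; 121; 105; 136; 111; 43; 226; 11; 124; 229; 267; 92; 137; 2;
60; 4; 209; 91; 23; 55; 247; 227; 36; 78; 104; 260; 69; 225; 244; 116; 7; 90; 199; 184;
109; 25; 238; 84; 9; 223; 54; 30; 186; 208; 188; 80; 240; 220; 1; 131; 75; 217; 172; 257;
97; 181; 130; 263; 77; 157; 12; 252; 166; 193; 171; 246; 176; 218; 96; 253; 173; 174; 129;
233; 37; 89; 20; 169; 192; 135; 133; 53; 74; 190; 95; 39; 29; 79; 255; 150; 70; 154; 47;
99; 179; 177; 112; 256; 101; 67; 274; 125; 82; 51; 6; 222; 160; 250; 162; 241; 140; 120;
72; 27; 262; 49; 254; 68; 221; 265; 110; 147; 165; 269; 273; 132; 175; 58; 158; 180; 159;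
32; 14; 224; 106; 234; 214; 207; 251; 228; 44; 245; 114; 83; 3; 203; 13; 211; 62; 113;
168; 5; 197; 204; 230; 170; 236; 271; 243; 146; 196; 76; 216; 64; 98; 164; 182; 149; 65;
156; 117; 163; 261; 198; 143; 128; 16; 118; 22; 248; 28; 86; 8; 35; 87; 242; 155; 126;
151; 200; 59; 270; 115; 231; 152; 127; 189; 213; 138; 268; 139; 88; 107; 272; 38; 40; 205;
122; 191; 73; 264; 52; 201; 19; 94; 102; 195; 144; 219; 123; 249; 167; 93; 161; 215; 17;
71; 187; 63; 18; 45; 258; 206; 34; 259; 145; 153; 56; 57; 142; 239; 103; 100; 235; 85; 50;
178; 41; 119; 237; 183; 266; 81; 24; 134; 61; 185; 212; 21; 15; 202; 10; 148; 31; 46; 108;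
210; 33]%num);
  (93, 3, 25, [::
217; 253; 225; 14; 108; 249; 123; 176; 184; 270; 250; 29; 127; 183; 118; 70; 166; 26; 11;
173; 77; 226; 87; 201; 210; 52; 3; 60; 15; 19; 149; 129; 25; 140; 135; 37; 46; 153; 276;
242; 169; 53; 36; 119; 104; 80; 34; 86; 240; 182; 179; 265; 124; 192; 200; 256; 82; 171;
194; 144; 257; 145; 232; 248; 30; 239; 97; 48; 271; 2; 198; 161; 212; 45; 207; 94; 105;
12; 125; 172; 235; 71; 264; 275; 147; 74; 44; 177; 228; 27; 114; 35; 190; 33; 156; 55;
185; 18; 227; 165; 16; 8; 208; 180; 65; 43; 28; 152; 170; 62; 84; 274; 174; 175; 266; 63;
112; 164; 188; 121; 56; 203; 163; 269; 193; 167; 116; 58; 154; 150; 146; 159; 110; 128;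
230; 6; 5; 89; 31; 64; 254; 107; 40; 157; 106; 21; 42; 187; 134; 216; 54; 238; 23; 255;
17; 131; 102; 199; 262; 51; 98; 120; 222; 72; 68; 92; 143; 206; 139; 101; 7; 122; 126; 59;
234; 41; 73; 88; 258; 178; 189; 20; 246; 205; 1; 160; 241; 215; 186; 261; 278; 259; 66;
209; 95; 251; 219; 38; 4; 100; 162; 93; 115; 243; 90; 85; 96; 231; 214; 39; 117; 148; 202;
247; 142; 111; 213; 9; 268; 197; 245; 263; 181; 244; 69; 61; 132; 137; 141; 273; 195; 103;
224; 47; 151; 218; 204; 130; 113; 223; 233; 252; 76; 24; 99; 211; 79; 155; 168; 133; 50;
91; 83; 78; 75; 32; 49; 22; 220; 237; 136; 267; 221; 10; 196; 158; 81; 109; 138; 277; 13;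
67; 272; 191; 260; 57; 236; 229]%num);
  (95, 3, 11, [::
219; 45; 199; 4; 47; 16; 209; 161; 153; 48; 127; 34; 144; 184; 38; 224; 118; 92; 87; 14;
89; 281; 246; 32; 267; 168; 276; 256; 201; 114; 282; 239; 17; 111; 271; 250; 244; 233;
222; 131; 54; 6; 139; 128; 79; 154; 185; 27; 238; 46; 66; 103; 97; 178; 78; 123; 151; 65;
220; 148; 165; 86; 50; 64; 257; 218; 105; 112; 226; 259; 216; 171; 31; 245; 275; 198; 124;
200; 280; 195; 206; 99; 183; 163; 263; 62; 169; 166; 36; 91; 15; 5; 189; 174; 235; 13;
162; 264; 136; 175; 121; 7; 152; 3; 170; 143; 88; 225; 49; 147; 35; 142; 21; 176; 277; 55;
70; 260; 28; 215; 262; 284; 101; 278; 8; 10; 221; 207; 53; 217; 210; 157; 140; 85; 212;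
104; 241; 100; 133; 211; 63; 134; 122; 74; 150; 108; 37; 247; 167; 96; 90; 255; 249; 52;
243; 191; 61; 192; 258; 237; 213; 93; 30; 137; 94; 160; 84; 173; 242; 25; 59; 33; 98; 20;
41; 57; 12; 266; 231; 39; 69; 208; 227; 23; 1; 71; 129; 179; 29; 149; 117; 228; 82; 109;
107; 156; 102; 44; 26; 119; 279; 130; 95; 73; 76; 2; 182; 240; 9; 177; 80; 158; 214; 60;
126; 236; 125; 261; 116; 188; 19; 196; 110; 194; 106; 135; 223; 274; 83; 248; 58; 24; 253;
180; 77; 254; 204; 11; 56; 138; 115; 18; 268; 22; 190; 40; 252; 272; 42; 67; 141; 164;
155; 232; 113; 120; 265; 230; 43; 197; 202; 203; 145; 68; 81; 187; 132; 181; 146; 269; 51;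
273; 159; 172; 270; 193; 251; 229; 72; 75; 186; 283; 205; 234]%num);
  (97, 3, 35, [::
259; 40; 17; 7; 21; 220; 65; 286; 256; 185; 139; 153; 126; 212; 54; 158; 142; 31; 1; 110;
204; 179; 287; 101; 201; 261; 109; 23; 276; 173; 257; 132; 200; 113; 225; 96; 127; 76;
105; 285; 34; 61; 2; 128; 104; 163; 115; 255; 49; 14; 119; 244; 155; 89; 164; 70; 215;
170; 253; 246; 103; 277; 95; 167; 268; 129; 227; 28; 202; 131; 151; 47; 52; 174; 27; 12;
73; 205; 29; 240; 60; 180; 262; 274; 82; 143; 214; 91; 270; 190; 120; 232; 271; 272; 75;
90; 162; 48; 102; 100; 218; 124; 230; 58; 32; 118; 189; 168; 20; 5; 125; 130; 258; 254;
238; 111; 83; 24; 18; 219; 165; 210; 226; 283; 79; 264; 282; 242; 85; 178; 159; 112; 263;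
237; 78; 252; 290; 281; 50; 68; 192; 195; 10; 157; 133; 148; 284; 279; 62; 228; 182; 63;
260; 122; 217; 206; 213; 172; 106; 248; 66; 149; 249; 166; 97; 26; 22; 81; 231; 30; 138;
199; 267; 117; 243; 145; 92; 9; 55; 234; 15; 198; 247; 44; 136; 144; 207; 4; 186; 45; 35;
116; 123; 193; 194; 156; 236; 46; 223; 84; 99; 250; 137; 13; 209; 94; 251; 288; 42; 74;
107; 134; 241; 239; 19; 57; 16; 3; 59; 273; 37; 67; 41; 184; 121; 141; 114; 152; 187; 51;
77; 150; 222; 146; 161; 39; 88; 245; 80; 175; 229; 196; 6; 72; 289; 71; 197; 216; 33; 36;
11; 53; 221; 181; 87; 233; 208; 278; 25; 93; 177; 160; 211; 38; 56; 169; 108; 203; 275;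
224; 235; 98; 188; 183; 69; 191; 171; 176; 266; 135; 154; 43; 269; 8; 64; 140; 280; 86;
265; 147]%num);
  (99, 3, 34, [::
148; 139; 116; 288; 248; 96; 266; 14; 211; 52; 287; 105; 138; 153; 272; 213; 250; 7; 15;
64; 294; 19; 40; 280; 81; 17; 144; 233; 78; 130; 122; 175; 95; 49; 237; 32; 137; 184; 108;
67; 94; 77; 270; 150; 192; 209; 141; 172; 129; 101; 84; 277; 296; 174; 251; 220; 26; 136;
18; 212; 86; 291; 274; 167; 22; 262; 180; 152; 39; 6; 163; 13; 269; 271; 135; 31; 109;
293; 103; 97; 253; 30; 236; 59; 106; 113; 177; 264; 151; 289; 261; 155; 128; 134; 92; 149;
221; 157; 23; 160; 215; 5; 80; 10; 279; 235; 278; 100; 107; 196; 48; 126; 33; 171; 210;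
142; 234; 255; 170; 275; 110; 85; 193; 165; 199; 82; 179; 50; 68; 244; 70; 254; 240; 58;
75; 286; 28; 185; 219; 229; 53; 27; 181; 76; 241; 259; 1; 218; 154; 260; 190; 203; 283;
227; 98; 66; 143; 222; 79; 56; 168; 57; 183; 21; 182; 42; 73; 191; 290; 111; 47; 2; 231;
217; 252; 133; 189; 69; 112; 200; 90; 161; 145; 204; 41; 164; 20; 132; 285; 232; 239; 257;
226; 208; 37; 273; 206; 246; 62; 29; 169; 123; 281; 268; 207; 121; 282; 119; 55; 216; 99;
225; 146; 65; 36; 72; 114; 284; 263; 71; 124; 147; 295; 8; 34; 214; 12; 60; 245; 243; 115;
247; 162; 102; 117; 194; 178; 276; 131; 45; 120; 186; 89; 54; 46; 205; 242; 104; 223; 202;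
265; 258; 74; 156; 127; 187; 224; 25; 140; 38; 256; 3; 4; 158; 87; 11; 43; 173; 292; 83;
188; 24; 197; 118; 198; 51; 201; 238; 88; 61; 125; 159; 195; 228; 176; 9; 249; 16; 267;
35; 166; 230; 63; 91; 44; 93]%num);
  (43, 7, 4, [::
169; 174; 264; 28; 272; 114; 49; 153; 109; 11; 179; 277; 162; 213; 167; 283; 115; 119;
228; 267; 253; 57; 276; 14; 163; 205; 191; 188; 6; 36; 69; 289; 100; 103; 31; 286; 203;
186; 34; 106; 130; 268; 155; 284; 18; 250; 128; 86; 256; 39; 211; 215; 5; 10; 90; 137;
152; 290; 295; 232; 142; 258; 150; 156; 9; 281; 173; 73; 293; 99; 269; 270; 60; 285; 81;
273; 25; 61; 210; 50; 7; 175; 194; 82; 131; 185; 107; 95; 235; 176; 46; 279; 105; 55; 16;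
177; 121; 88; 141; 207; 62; 240; 80; 236; 65; 197; 135; 27; 127; 41; 98; 96; 239; 200;
143; 218; 21; 255; 23; 132; 66; 75; 102; 30; 233; 223; 206; 278; 29; 2; 15; 298; 37; 133;
170; 22; 198; 78; 68; 249; 123; 199; 54; 111; 72; 275; 229; 165; 178; 101; 159; 166; 282;
248; 208; 241; 43; 8; 113; 244; 296; 266; 126; 217; 145; 220; 77; 59; 91; 19; 74; 129; 51;
193; 292; 164; 35; 261; 262; 76; 154; 94; 226; 63; 12; 299; 243; 234; 294; 97; 161; 24;
108; 201; 104; 93; 251; 242; 274; 52; 190; 227; 183; 204; 254; 214; 116; 33; 219; 71; 246;
252; 287; 42; 122; 84; 300; 112; 48; 196; 224; 38; 230; 288; 83; 56; 172; 202; 259; 110;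
92; 212; 146; 26; 280; 231; 124; 53; 148; 45; 4; 168; 209; 221; 216; 125; 187; 47; 40;
138; 181; 151; 180; 117; 260; 195; 20; 144; 17; 182; 118; 44; 149; 64; 184; 89; 271; 13;
58; 257; 265; 140; 160; 70; 291; 192; 247; 136; 189; 85; 120; 1; 222; 139; 134; 171; 237;
245; 297; 147; 67; 263; 32; 238; 157; 3; 225; 158; 79; 87]%num);
  (61, 5, 9, [::
186; 275; 172; 29; 17; 140; 108; 60; 32; 277; 63; 271; 125; 46; 197; 185; 203; 69; 213;
188; 43; 179; 23; 170; 157; 176; 36; 30; 205; 74; 99; 139; 251; 103; 244; 72; 48; 162;
282; 269; 38; 223; 160; 71; 245; 56; 92; 231; 137; 35; 202; 138; 216; 141; 78; 105; 287;
44; 194; 7; 199; 236; 79; 147; 301; 119; 270; 42; 115; 235; 95; 196; 58; 299; 33; 65; 167;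
218; 133; 152; 220; 132; 195; 86; 102; 215; 62; 41; 59; 130; 127; 254; 4; 61; 163; 249;
291; 239; 91; 53; 8; 28; 258; 155; 106; 266; 93; 181; 156; 135; 242; 9; 190; 292; 240;
300; 187; 5; 289; 288; 219; 117; 143; 49; 180; 250; 191; 70; 109; 280; 107; 274; 217; 166;
237; 14; 77; 169; 11; 3; 248; 283; 20; 284; 221; 255; 101; 10; 232; 126; 153; 57; 110; 94;
200; 24; 6; 257; 233; 76; 83; 241; 2; 285; 178; 295; 22; 256; 262; 273; 182; 177; 13; 112;
52; 15; 118; 193; 276; 37; 263; 34; 55; 149; 260; 290; 98; 84; 201; 293; 272; 198; 302;
66; 31; 214; 121; 124; 224; 151; 161; 123; 168; 259; 192; 40; 111; 267; 294; 207; 68; 142;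
268; 230; 150; 148; 225; 116; 97; 45; 16; 261; 228; 303; 96; 19; 27; 210; 159; 21; 82; 67;
206; 50; 208; 171; 88; 253; 1; 100; 243; 26; 278; 246; 114; 64; 146; 296; 297; 184; 286;
227; 234; 87; 122; 145; 129; 183; 209; 54; 211; 144; 134; 165; 164; 281; 73; 51; 80; 229;
298; 173; 128; 175; 189; 12; 90; 247; 212; 81; 204; 304; 136; 222; 39; 18; 279; 264; 113;
85; 131; 47; 120; 104; 252; 238; 226; 174; 25; 265; 158; 75; 154; 89]%num);
  (103, 3, 46, [::
140; 214; 71; 46; 289; 272; 68; 169; 163; 279; 172; 206; 186; 92; 190; 69; 31; 243; 132;
277; 151; 144; 167; 229; 168; 87; 143; 307; 45; 281; 37; 300; 131; 104; 223; 139; 298;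
103; 19; 118; 141; 210; 278; 266; 36; 269; 261; 84; 29; 286; 301; 198; 211; 160; 127; 183;
129; 93; 77; 89; 60; 297; 9; 145; 78; 288; 282; 175; 153; 226; 110; 50; 81; 64; 270; 250;
230; 246; 176; 166; 181; 152; 296; 121; 76; 308; 221; 285; 17; 228; 253; 99; 15; 38; 11;
244; 268; 255; 264; 123; 138; 28; 85; 241; 20; 263; 237; 40; 135; 114; 274; 174; 79; 280;
220; 54; 117; 208; 185; 195; 94; 18; 202; 209; 235; 137; 73; 217; 63; 41; 25; 42; 256;
119; 170; 225; 184; 271; 155; 136; 258; 7; 259; 102; 156; 62; 148; 306; 124; 122; 67; 299;
120; 203; 204; 162; 49; 1; 109; 284; 56; 215; 231; 66; 142; 189; 201; 2; 113; 30; 276;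
260; 72; 199; 249; 112; 239; 232; 295; 115; 154; 96; 187; 207; 52; 248; 16; 251; 205; 6;
267; 188; 291; 302; 105; 39; 227; 48; 161; 245; 74; 292; 51; 265; 57; 107; 242; 83; 100;
193; 10; 128; 200; 4; 287; 86; 91; 23; 88; 192; 80; 65; 177; 150; 293; 43; 24; 108; 222;
283; 180; 13; 179; 61; 147; 178; 275; 247; 21; 252; 47; 213; 164; 14; 134; 98; 236; 240;
26; 55; 90; 111; 173; 303; 32; 70; 171; 158; 59; 219; 27; 12; 149; 130; 159; 58; 33; 196;
5; 157; 254; 97; 146; 75; 125; 106; 34; 44; 238; 234; 82; 197; 194; 101; 116; 3; 53; 290;
218; 304; 95; 273; 262; 126; 224; 191; 165; 133; 216; 182; 233; 257; 212; 305; 294; 22; 8;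
35]%num);
  (105, 3, 16, [::
156; 162; 180; 108; 263; 268; 141; 82; 2; 199; 184; 170; 283; 145; 148; 274; 220; 32; 181;
39; 310; 135; 267; 176; 69; 290; 186; 22; 34; 238; 289; 160; 299; 89; 239; 55; 130; 152;
250; 280; 285; 300; 173; 222; 308; 56; 282; 188; 80; 216; 169; 215; 59; 61; 295; 151; 219;
72; 43; 211; 17; 245; 30; 174; 292; 278; 221; 165; 231; 70; 9; 201; 31; 98; 21; 287; 1;
276; 286; 153; 64; 206; 262; 202; 270; 159; 296; 122; 116; 182; 224; 178; 272; 100; 255;
157; 26; 164; 76; 48; 28; 137; 134; 243; 131; 29; 248; 265; 50; 271; 101; 40; 314; 53; 97;
57; 189; 288; 168; 20; 120; 45; 191; 223; 225; 127; 253; 133; 306; 232; 123; 140; 104;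
273; 147; 42; 121; 242; 254; 102; 275; 51; 210; 10; 161; 194; 109; 234; 158; 54; 207; 269;
200; 16; 94; 38; 25; 258; 154; 15; 71; 117; 171; 37; 298; 240; 241; 277; 244; 179; 41; 23;
44; 281; 93; 294; 12; 213; 166; 24; 142; 279; 260; 196; 301; 114; 107; 307; 237; 228; 214;
309; 229; 103; 7; 198; 35; 146; 212; 87; 75; 115; 126; 112; 5; 6; 192; 264; 3; 4; 163;
297; 209; 52; 261; 136; 217; 205; 266; 190; 175; 311; 226; 259; 14; 257; 67; 58; 110; 249;
63; 312; 8; 218; 230; 227; 105; 124; 256; 139; 65; 111; 77; 46; 92; 47; 113; 197; 247;
302; 106; 172; 95; 19; 78; 150; 88; 18; 27; 84; 284; 90; 36; 183; 185; 155; 62; 305; 236;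
208; 235; 83; 293; 291; 128; 86; 143; 33; 187; 11; 246; 73; 233; 303; 252; 74; 96; 195;
138; 144; 79; 119; 167; 125; 304; 68; 203; 118; 81; 177; 60; 99; 85; 204; 132; 313; 149;
193; 66; 13; 129; 251; 91; 49]%num);
  (109, 3, 45, [::
167; 221; 63; 124; 154; 182; 193; 176; 199; 49; 277; 166; 211; 87; 127; 165; 187; 48; 56;
74; 82; 169; 16; 151; 81; 94; 232; 149; 190; 292; 142; 289; 52; 43; 11; 213; 115; 284; 25;
134; 288; 84; 80; 194; 101; 65; 227; 256; 275; 120; 66; 78; 299; 5; 117; 45; 285; 273; 83;
13; 41; 135; 95; 263; 125; 281; 196; 197; 184; 160; 88; 178; 68; 198; 170; 61; 20; 185;
162; 192; 23; 1; 177; 207; 228; 32; 305; 286; 316; 54; 105; 44; 248; 31; 326; 159; 223;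
307; 36; 24; 319; 203; 22; 296; 57; 173; 19; 67; 323; 8; 308; 18; 93; 264; 205; 119; 86;
311; 59; 304; 155; 317; 276; 143; 321; 26; 37; 186; 4; 274; 71; 300; 51; 259; 217; 222;
85; 294; 130; 172; 62; 243; 210; 280; 171; 128; 110; 132; 50; 245; 315; 181; 290; 206;
116; 220; 136; 267; 92; 129; 229; 269; 91; 183; 325; 253; 291; 271; 73; 27; 99; 298; 111;
175; 239; 320; 209; 106; 216; 168; 233; 21; 108; 247; 97; 122; 98; 240; 104; 236; 15; 246;
148; 10; 96; 79; 163; 152; 270; 123; 28; 70; 287; 279; 3; 234; 231; 225; 322; 141; 237;
265; 69; 261; 138; 251; 102; 6; 9; 139; 157; 42; 47; 260; 293; 126; 150; 114; 295; 219;
90; 324; 250; 64; 46; 2; 200; 257; 72; 76; 133; 121; 301; 297; 158; 262; 153; 226; 309;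
302; 212; 12; 38; 215; 179; 7; 147; 77; 214; 103; 29; 113; 318; 224; 145; 201; 314; 188;
312; 137; 39; 144; 89; 109; 118; 255; 195; 112; 33; 34; 55; 244; 303; 266; 100; 242; 204;
146; 14; 283; 306; 252; 218; 131; 180; 53; 278; 191; 189; 254; 310; 258; 164; 249; 35;
238; 202; 272; 313; 241; 235; 140; 30; 75; 174; 161; 282; 107; 156; 40; 60; 230; 17; 208;
268; 58]%num);
  (111, 3, 10, [::
45; 32; 186; 283; 115; 76; 295; 257; 58; 231; 35; 184; 167; 263; 282; 239; 176; 209; 259;
131; 306; 99; 25; 297; 332; 42; 235; 251; 191; 50; 160; 22; 254; 161; 9; 109; 71; 258;
245; 69; 207; 244; 98; 330; 168; 105; 212; 299; 187; 201; 33; 274; 307; 166; 317; 195; 17;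
301; 124; 147; 192; 85; 51; 247; 304; 230; 65; 288; 305; 61; 104; 84; 178; 229; 276; 248;
12; 78; 237; 106; 141; 140; 200; 89; 173; 216; 312; 142; 49; 72; 118; 260; 143; 198; 174;
324; 172; 130; 87; 221; 110; 215; 220; 233; 203; 64; 269; 234; 275; 15; 36; 268; 328; 189;
323; 165; 208; 294; 218; 10; 188; 94; 96; 44; 278; 270; 327; 116; 292; 226; 227; 177; 48;
112; 302; 37; 127; 211; 293; 170; 157; 79; 300; 56; 199; 190; 119; 219; 325; 223; 145;
267; 225; 21; 5; 228; 92; 135; 319; 310; 91; 144; 103; 249; 196; 194; 29; 123; 121; 285;
146; 108; 204; 241; 100; 13; 286; 31; 331; 77; 185; 309; 182; 11; 57; 213; 256; 156; 255;
298; 266; 120; 133; 53; 132; 59; 202; 273; 67; 214; 28; 210; 252; 8; 125; 111; 158; 291;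
280; 243; 38; 287; 97; 55; 284; 321; 102; 19; 322; 262; 80; 60; 134; 43; 14; 162; 222;
318; 86; 81; 206; 205; 122; 6; 163; 107; 311; 83; 128; 197; 271; 224; 180; 4; 16; 181;
152; 155; 326; 217; 66; 164; 34; 290; 26; 171; 47; 136; 82; 101; 183; 238; 54; 40; 62;
246; 7; 250; 150; 303; 151; 315; 329; 139; 193; 138; 179; 175; 126; 68; 153; 88; 70; 41;
264; 20; 313; 114; 240; 27; 73; 279; 63; 117; 320; 308; 232; 3; 154; 272; 18; 236; 137;
169; 253; 159; 281; 242; 129; 75; 30; 148; 265; 1; 24; 277; 93; 46; 289; 316; 2; 149; 95;
261; 113; 23; 90; 52; 314; 296; 39; 74]%num);
  (49, 7, 8, [::
205; 68; 259; 305; 176; 202; 186; 211; 204; 28; 172; 280; 195; 236; 199; 153; 174; 98;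
103; 294; 120; 293; 72; 79; 248; 289; 181; 224; 221; 169; 119; 234; 83; 208; 62; 38; 239;
85; 326; 308; 191; 53; 102; 273; 123; 113; 319; 152; 162; 52; 201; 328; 91; 200; 187; 155;
254; 149; 184; 47; 59; 21; 272; 243; 247; 142; 64; 228; 133; 242; 86; 126; 240; 7; 331;
94; 20; 92; 196; 19; 163; 154; 27; 189; 217; 114; 258; 78; 317; 23; 212; 277; 170; 39;
190; 147; 11; 219; 13; 246; 130; 46; 342; 118; 264; 136; 282; 310; 140; 76; 185; 285; 260;
253; 283; 99; 42; 223; 112; 180; 278; 15; 108; 325; 227; 279; 45; 255; 301; 336; 105; 235;
16; 229; 291; 252; 22; 128; 244; 318; 322; 314; 214; 179; 31; 109; 290; 24; 145; 51; 266;
90; 324; 150; 178; 281; 77; 43; 168; 295; 129; 158; 131; 75; 157; 171; 54; 304; 35; 311;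
30; 183; 334; 44; 58; 56; 96; 262; 116; 6; 66; 284; 296; 107; 197; 303; 73; 265; 32; 41;
335; 298; 12; 339; 125; 88; 138; 307; 144; 110; 81; 2; 49; 327; 156; 288; 93; 135; 222;
194; 256; 84; 36; 100; 270; 106; 117; 161; 139; 269; 115; 338; 249; 37; 5; 29; 306; 218;
213; 241; 10; 177; 237; 26; 299; 121; 274; 309; 267; 225; 188; 65; 193; 323; 48; 1; 292;
203; 216; 143; 148; 341; 104; 198; 166; 297; 146; 9; 160; 165; 315; 250; 316; 141; 89;
263; 122; 276; 167; 182; 206; 82; 245; 173; 233; 175; 127; 251; 192; 8; 300; 329; 137;
209; 257; 271; 63; 4; 97; 231; 164; 14; 69; 159; 261; 57; 111; 215; 286; 321; 313; 18;
238; 34; 87; 3; 33; 25; 67; 302; 134; 210; 101; 332; 61; 337; 320; 17; 275; 40; 70; 151;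
74; 268; 124; 230; 71; 340; 333; 50; 207; 220; 287; 226; 132; 232; 312; 95; 55; 330; 80;
60]%num);
  (117, 3, 16, [::
130; 165; 97; 104; 67; 330; 65; 266; 236; 63; 244; 281; 208; 296; 194; 112; 211; 181; 201;
40; 259; 121; 3; 277; 301; 93; 41; 117; 189; 54; 192; 73; 2; 107; 269; 128; 263; 202; 24;
234; 37; 283; 191; 126; 15; 57; 320; 92; 79; 321; 261; 176; 52; 49; 86; 253; 110; 68; 19;
70; 238; 311; 246; 80; 230; 304; 339; 150; 88; 223; 173; 212; 72; 345; 32; 198; 83; 264;
240; 164; 204; 249; 332; 177; 48; 109; 288; 344; 69; 243; 159; 325; 197; 275; 91; 18; 160;
21; 135; 347; 16; 82; 309; 228; 298; 156; 42; 99; 260; 172; 271; 184; 10; 45; 174; 147;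
43; 314; 180; 237; 205; 106; 78; 120; 81; 286; 297; 129; 227; 336; 346; 239; 303; 334;
254; 71; 5; 84; 195; 111; 28; 251; 132; 280; 265; 98; 299; 116; 13; 51; 220; 77; 257; 276;
306; 337; 74; 175; 25; 127; 292; 94; 310; 267; 14; 219; 329; 115; 185; 293; 131; 31; 203;
232; 250; 100; 151; 20; 349; 338; 167; 242; 11; 134; 87; 35; 162; 138; 59; 307; 139; 105;
289; 199; 85; 226; 255; 245; 335; 333; 141; 218; 328; 342; 285; 183; 64; 190; 200; 317;
75; 50; 76; 95; 241; 169; 44; 323; 61; 252; 287; 163; 324; 225; 300; 206; 102; 34; 216; 1;
66; 96; 312; 213; 103; 196; 152; 122; 89; 155; 27; 140; 340; 119; 7; 231; 149; 133; 305;
113; 295; 319; 146; 272; 279; 22; 318; 224; 187; 144; 46; 9; 235; 270; 154; 90; 217; 114;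
39; 313; 316; 229; 148; 350; 274; 308; 158; 209; 161; 327; 171; 268; 233; 348; 62; 143;
23; 294; 166; 302; 118; 290; 101; 8; 215; 322; 33; 157; 331; 278; 123; 55; 124; 291; 193;
282; 136; 341; 47; 214; 30; 108; 60; 6; 153; 29; 26; 53; 182; 256; 273; 38; 262; 58; 12;
210; 247; 17; 125; 179; 186; 207; 222; 36; 221; 142; 137; 178; 145; 4; 168; 284; 248; 315;
326; 258; 56; 188; 343; 170]%num);
  (71, 5, 5, [::
1; 82; 150; 75; 6; 107; 251; 284; 322; 101; 334; 73; 116; 188; 15; 31; 226; 177; 153; 324;
40; 259; 289; 98; 147; 335; 157; 131; 110; 4; 24; 128; 214; 244; 308; 241; 237; 319; 139;
271; 310; 176; 29; 12; 189; 46; 267; 344; 112; 34; 2; 77; 16; 215; 54; 196; 167; 233; 270;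
275; 154; 25; 102; 120; 282; 312; 297; 277; 48; 238; 272; 293; 47; 67; 175; 294; 330; 257;
269; 60; 207; 160; 292; 227; 95; 208; 90; 200; 106; 212; 327; 291; 184; 329; 187; 264; 61;
218; 236; 255; 38; 126; 323; 250; 256; 205; 66; 28; 89; 301; 273; 13; 179; 27; 172; 353;
76; 79; 169; 234; 117; 339; 228; 263; 134; 258; 137; 91; 168; 138; 145; 229; 302; 354;
287; 132; 213; 191; 97; 332; 209; 123; 136; 280; 70; 224; 152; 100; 5; 83; 124; 99; 307;
222; 49; 201; 341; 21; 18; 285; 345; 92; 315; 105; 211; 283; 350; 343; 26; 242; 246; 3;
19; 151; 142; 352; 279; 114; 193; 316; 268; 171; 129; 14; 63; 199; 349; 190; 314; 165; 86;
318; 122; 278; 58; 296; 216; 210; 311; 162; 135; 186; 23; 104; 93; 180; 281; 17; 333; 336;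
146; 103; 37; 156; 30; 346; 313; 59; 298; 96; 119; 51; 39; 56; 197; 351; 338; 57; 94; 203;
225; 248; 223; 192; 265; 198; 43; 68; 121; 342; 231; 52; 170; 266; 340; 53; 230; 140; 219;
202; 182; 127; 148; 247; 158; 74; 217; 20; 35; 111; 274; 306; 22; 331; 194; 62; 72; 144;
174; 44; 55; 36; 347; 348; 232; 325; 253; 262; 276; 221; 181; 64; 239; 220; 65; 235; 84;
183; 87; 8; 11; 286; 328; 320; 163; 141; 317; 149; 309; 109; 33; 80; 10; 206; 155; 88;
303; 240; 7; 164; 113; 254; 288; 204; 260; 78; 337; 81; 71; 304; 41; 130; 108; 159; 32;
185; 69; 161; 243; 261; 252; 245; 249; 45; 85; 295; 299; 290; 125; 50; 133; 300; 9; 42;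
143; 195; 326; 321; 173; 305; 118; 178; 166; 115]%num);
  (119, 3, 18, [::
182; 181; 192; 85; 117; 52; 341; 162; 156; 244; 325; 235; 211; 96; 148; 153; 299; 93; 102;
252; 113; 23; 28; 213; 207; 155; 290; 273; 258; 349; 94; 321; 229; 306; 186; 307; 329;
348; 232; 212; 68; 128; 47; 65; 238; 163; 25; 209; 16; 332; 90; 205; 62; 7; 196; 48; 331;
308; 22; 263; 41; 74; 114; 189; 66; 278; 95; 340; 319; 293; 106; 301; 294; 30; 46; 183;
147; 3; 159; 130; 40; 61; 136; 37; 78; 31; 295; 83; 302; 272; 203; 8; 337; 304; 288; 86;
73; 87; 242; 216; 221; 249; 139; 119; 152; 245; 217; 210; 350; 71; 346; 247; 225; 126;
228; 313; 344; 326; 150; 198; 250; 125; 67; 296; 174; 44; 15; 316; 142; 328; 10; 275; 256;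
343; 21; 234; 262; 356; 243; 141; 20; 281; 175; 137; 310; 13; 35; 109; 267; 303; 49; 169;
124; 64; 14; 334; 149; 240; 89; 50; 42; 354; 239; 292; 318; 54; 129; 180; 257; 222; 298;
36; 165; 58; 173; 312; 120; 184; 133; 277; 214; 1; 167; 311; 164; 88; 259; 231; 103; 69;
111; 51; 345; 333; 309; 108; 330; 199; 188; 269; 190; 336; 172; 200; 45; 315; 98; 160; 53;
122; 193; 338; 118; 179; 283; 38; 289; 276; 197; 17; 251; 233; 279; 33; 84; 324; 260; 100;
291; 145; 18; 254; 151; 202; 26; 77; 218; 116; 327; 241; 237; 75; 226; 266; 2; 55; 24; 97;
110; 176; 138; 82; 115; 143; 265; 178; 170; 187; 261; 282; 19; 224; 220; 72; 134; 355;
284; 135; 314; 342; 168; 60; 248; 177; 215; 351; 123; 43; 154; 92; 317; 127; 57; 253; 339;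
270; 140; 70; 112; 101; 201; 236; 287; 300; 161; 264; 27; 6; 59; 274; 91; 5; 171; 255; 34;
157; 39; 29; 268; 166; 246; 63; 322; 105; 12; 320; 132; 107; 4; 81; 227; 230; 9; 323; 185;
80; 285; 347; 208; 206; 219; 79; 223; 305; 76; 158; 191; 335; 131; 99; 204; 271; 121; 297;
353; 146; 56; 195; 144; 286; 104; 280; 194; 11; 32; 352]%num);
  (75, 5, 16, [::
21; 178; 234; 189; 230; 346; 18; 87; 101; 108; 365; 318; 211; 73; 176; 229; 107; 353; 236;
119; 288; 109; 340; 367; 112; 200; 27; 41; 359; 250; 58; 261; 327; 295; 156; 215; 130;
106; 67; 280; 96; 16; 89; 368; 151; 240; 80; 196; 135; 290; 125; 83; 208; 255; 362; 102;
59; 199; 223; 221; 180; 86; 302; 239; 39; 46; 136; 275; 210; 10; 127; 8; 213; 36; 354;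
289; 244; 348; 224; 281; 228; 30; 71; 147; 43; 142; 166; 75; 273; 193; 222; 100; 65; 194;
333; 115; 351; 110; 259; 268; 120; 128; 98; 246; 361; 313; 157; 50; 195; 232; 284; 357;
163; 332; 111; 323; 251; 269; 203; 63; 271; 1; 360; 314; 247; 301; 297; 205; 2; 243; 161;
24; 294; 356; 227; 186; 265; 285; 51; 3; 349; 191; 270; 292; 25; 48; 162; 33; 272; 190;
242; 35; 334; 145; 310; 54; 206; 104; 235; 165; 31; 330; 28; 324; 40; 5; 99; 6; 153; 64;
174; 305; 94; 76; 143; 45; 79; 15; 117; 293; 152; 253; 133; 88; 325; 81; 66; 167; 344;
209; 219; 123; 26; 173; 328; 343; 220; 329; 317; 202; 72; 263; 69; 335; 160; 169; 170;
252; 303; 316; 78; 77; 373; 146; 56; 124; 82; 62; 19; 192; 150; 231; 175; 184; 68; 38;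
306; 197; 238; 312; 139; 34; 341; 286; 113; 32; 233; 237; 337; 226; 339; 90; 249; 207;
309; 159; 256; 60; 70; 85; 258; 350; 122; 91; 114; 260; 347; 9; 198; 336; 277; 366; 204;
315; 331; 61; 188; 132; 245; 298; 262; 279; 342; 257; 164; 182; 358; 155; 278; 92; 355;
47; 20; 276; 118; 126; 201; 363; 371; 370; 52; 364; 134; 7; 266; 84; 217; 372; 307; 93;
131; 352; 53; 97; 322; 95; 225; 374; 103; 287; 154; 214; 116; 311; 168; 299; 264; 300;
248; 338; 37; 105; 12; 185; 187; 171; 149; 23; 4; 17; 172; 274; 49; 308; 369; 144; 141;
137; 181; 14; 254; 129; 179; 321; 44; 42; 218; 283; 138; 296; 11; 29; 241; 140; 216; 177;
282; 212; 319; 55; 121; 148; 13; 57; 22; 74; 183; 304; 326; 158; 320; 345; 291; 267]%num);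
  (127, 3, 19, [::
45; 51; 256; 273; 254; 131; 115; 243; 351; 326; 267; 242; 162; 207; 377; 250; 140; 371;
221; 114; 30; 163; 291; 373; 67; 219; 52; 354; 319; 303; 29; 48; 84; 12; 155; 125; 240;
208; 226; 263; 199; 151; 353; 4; 313; 62; 149; 196; 60; 134; 138; 86; 258; 348; 257; 220;
109; 92; 99; 300; 380; 195; 370; 172; 121; 25; 46; 204; 213; 275; 369; 76; 364; 94; 57;
141; 214; 197; 342; 285; 325; 232; 372; 136; 31; 206; 88; 56; 175; 255; 229; 312; 293;
159; 10; 77; 365; 338; 211; 13; 296; 178; 239; 209; 217; 129; 346; 112; 98; 49; 26; 170;
283; 277; 33; 145; 41; 269; 322; 23; 284; 337; 246; 279; 224; 202; 146; 270; 186; 374; 22;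
79; 359; 317; 21; 124; 116; 117; 74; 102; 260; 143; 72; 147; 292; 350; 174; 259; 289; 66;
368; 59; 268; 113; 356; 286; 73; 188; 327; 363; 55; 304; 103; 135; 290; 35; 126; 248; 78;
104; 223; 236; 1; 205; 344; 14; 7; 362; 154; 43; 314; 90; 339; 227; 28; 34; 95; 64; 133;
367; 97; 315; 358; 8; 187; 301; 105; 148; 366; 332; 251; 139; 18; 89; 194; 17; 65; 343;
107; 6; 321; 345; 123; 54; 306; 36; 118; 347; 119; 200; 68; 329; 272; 333; 9; 180; 274;
218; 212; 216; 249; 341; 352; 61; 167; 38; 222; 192; 228; 152; 295; 334; 82; 203; 233;
297; 349; 71; 164; 128; 201; 308; 336; 241; 24; 276; 15; 193; 81; 235; 80; 40; 280; 20;
261; 287; 111; 265; 63; 281; 323; 330; 262; 316; 375; 357; 302; 215; 150; 210; 328; 11;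
158; 47; 160; 101; 169; 168; 278; 355; 130; 108; 3; 171; 324; 245; 298; 282; 44; 75; 85;
165; 69; 238; 311; 5; 189; 234; 53; 83; 335; 360; 137; 183; 42; 225; 184; 142; 179; 379;
378; 320; 247; 294; 237; 253; 252; 271; 176; 307; 305; 27; 266; 181; 166; 39; 340; 191;
87; 190; 106; 153; 198; 91; 120; 361; 110; 132; 182; 161; 310; 93; 32; 127; 100; 19; 2;
173; 376; 244; 37; 122; 70; 231; 177; 264; 16; 96; 185; 309; 230; 318; 299; 156; 50; 157;
58; 144; 288; 331]%num);
  (77, 5, 15, [::
73; 123; 106; 67; 31; 309; 382; 380; 208; 299; 139; 187; 361; 49; 222; 331; 251; 199; 58;
20; 108; 283; 362; 95; 228; 345; 51; 381; 289; 201; 291; 1; 172; 47; 274; 216; 181; 119;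
138; 268; 147; 5; 214; 366; 344; 21; 3; 193; 330; 167; 303; 271; 375; 335; 249; 72; 156;
370; 185; 358; 89; 151; 236; 100; 26; 232; 300; 238; 265; 263; 255; 346; 284; 218; 318;
111; 354; 207; 122; 371; 294; 248; 272; 70; 169; 153; 178; 215; 62; 52; 82; 14; 85; 81;
130; 64; 337; 113; 253; 191; 290; 321; 226; 360; 245; 18; 37; 224; 54; 316; 117; 246; 133;
367; 308; 135; 182; 240; 327; 120; 233; 325; 7; 115; 162; 244; 247; 63; 161; 91; 326; 92;
225; 348; 98; 205; 141; 177; 273; 76; 365; 126; 159; 285; 34; 355; 68; 235; 295; 103; 188;
347; 154; 2; 241; 301; 189; 22; 41; 213; 152; 334; 234; 8; 48; 341; 219; 116; 353; 146;
221; 368; 343; 97; 311; 175; 78; 124; 136; 32; 262; 333; 53; 17; 195; 43; 340; 83; 186;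
128; 256; 203; 36; 158; 297; 129; 60; 312; 264; 168; 6; 194; 210; 30; 179; 239; 174; 59;
171; 270; 287; 79; 183; 350; 61; 190; 165; 374; 305; 198; 227; 243; 314; 220; 259; 307;
55; 302; 155; 383; 192; 45; 329; 38; 4; 250; 15; 127; 42; 280; 364; 166; 373; 212; 279;
148; 359; 35; 217; 209; 143; 105; 16; 286; 104; 349; 338; 84; 200; 102; 144; 24; 145; 293;
86; 323; 258; 118; 125; 206; 292; 87; 173; 11; 46; 33; 202; 77; 351; 99; 109; 176; 157;
378; 277; 9; 298; 110; 134; 254; 242; 163; 23; 57; 278; 237; 230; 320; 149; 65; 257; 377;
304; 101; 306; 150; 142; 40; 275; 184; 252; 170; 204; 317; 363; 12; 282; 71; 372; 276;
339; 296; 56; 121; 288; 90; 39; 267; 260; 75; 80; 379; 223; 137; 27; 44; 112; 315; 131;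
197; 74; 336; 356; 322; 114; 357; 376; 328; 313; 69; 28; 29; 261; 25; 10; 319; 269; 332;
50; 342; 310; 164; 94; 281; 19; 231; 107; 66; 324; 180; 160; 132; 229; 93; 384; 140; 352;
211; 96; 13; 196; 88; 369; 266]%num);
  (129, 3, 49, [::
143; 359; 330; 197; 53; 167; 21; 69; 145; 105; 116; 343; 219; 104; 295; 236; 360; 85; 264;
273; 126; 296; 12; 245; 151; 341; 345; 103; 115; 164; 380; 210; 338; 214; 65; 156; 262;
322; 39; 125; 337; 195; 232; 177; 196; 228; 108; 204; 111; 91; 275; 60; 73; 109; 185; 261;
302; 301; 188; 132; 54; 221; 182; 64; 257; 321; 44; 306; 279; 356; 142; 122; 274; 351;
278; 309; 162; 30; 150; 203; 166; 352; 305; 340; 342; 27; 22; 350; 336; 9; 11; 281; 367;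
373; 215; 127; 165; 269; 128; 297; 348; 378; 369; 288; 290; 349; 277; 10; 42; 285; 226;
84; 97; 5; 300; 52; 368; 16; 283; 241; 205; 229; 181; 289; 355; 80; 224; 35; 271; 194;
294; 227; 267; 36; 124; 268; 147; 293; 118; 178; 286; 223; 90; 114; 93; 347; 361; 113;
381; 216; 339; 37; 265; 190; 183; 154; 95; 72; 225; 172; 3; 71; 213; 191; 247; 14; 88;
137; 249; 169; 260; 26; 251; 362; 92; 57; 370; 385; 366; 157; 2; 119; 163; 129; 358; 317;
76; 70; 315; 74; 310; 49; 259; 99; 174; 94; 333; 89; 255; 50; 287; 63; 384; 146; 254; 133;
176; 1; 55; 153; 299; 25; 246; 371; 148; 328; 327; 357; 184; 272; 258; 332; 4; 139; 155;
263; 180; 314; 120; 193; 252; 136; 23; 208; 235; 75; 377; 121; 304; 376; 244; 231; 372;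
207; 40; 253; 173; 170; 59; 32; 77; 38; 344; 56; 334; 79; 238; 6; 374; 308; 187; 198; 101;
20; 46; 31; 98; 206; 220; 152; 17; 135; 199; 192; 217; 117; 45; 47; 112; 284; 298; 41; 58;
222; 43; 230; 15; 131; 242; 13; 233; 383; 379; 171; 140; 200; 218; 386; 28; 364; 83; 319;
48; 365; 303; 160; 237; 158; 248; 186; 311; 375; 86; 212; 382; 323; 138; 67; 211; 189; 82;
292; 331; 209; 239; 243; 7; 110; 159; 363; 161; 107; 179; 102; 270; 8; 141; 250; 29; 33;
24; 276; 346; 68; 325; 201; 96; 34; 19; 168; 313; 324; 144; 316; 326; 353; 130; 51; 234;
256; 266; 87; 78; 202; 106; 307; 329; 100; 318; 61; 175; 312; 291; 123; 320; 240; 62; 280;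
335; 134; 149; 66; 354; 18; 81; 282]%num);
  (133, 3, 11, [::
17; 11; 381; 129; 187; 122; 383; 8; 317; 38; 2; 85; 345; 198; 147; 270; 315; 332; 5; 140;
166; 146; 124; 207; 61; 130; 356; 288; 189; 343; 60; 254; 282; 36; 106; 386; 65; 276; 109;
155; 41; 305; 353; 177; 14; 160; 64; 152; 297; 352; 200; 253; 398; 294; 136; 144; 164;
186; 151; 235; 18; 26; 116; 255; 310; 259; 330; 16; 274; 246; 70; 216; 139; 158; 337; 228;
281; 292; 15; 217; 271; 162; 215; 153; 145; 168; 211; 326; 378; 29; 244; 190; 75; 201;
204; 336; 360; 58; 78; 115; 393; 296; 214; 261; 373; 219; 42; 247; 225; 156; 368; 69; 21;
50; 273; 35; 238; 77; 236; 6; 161; 320; 128; 163; 344; 220; 293; 242; 329; 298; 250; 252;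
213; 48; 51; 221; 178; 28; 203; 55; 19; 95; 355; 396; 127; 256; 9; 308; 316; 80; 335; 249;
174; 150; 374; 97; 32; 185; 295; 98; 4; 208; 307; 309; 284; 88; 143; 363; 212; 392; 291;
119; 286; 289; 59; 165; 13; 397; 173; 287; 241; 84; 362; 342; 66; 44; 240; 142; 87; 233;
224; 52; 312; 319; 369; 341; 76; 351; 114; 384; 107; 372; 154; 243; 359; 338; 121; 71; 96;
179; 354; 375; 89; 25; 167; 223; 194; 334; 328; 340; 159; 327; 40; 182; 209; 31; 264; 191;
391; 103; 117; 347; 53; 72; 283; 358; 304; 100; 134; 303; 113; 245; 227; 367; 137; 45;
180; 193; 361; 94; 22; 126; 350; 148; 30; 123; 141; 277; 118; 93; 290; 325; 265; 301; 349;
192; 232; 81; 311; 218; 74; 197; 27; 257; 57; 138; 323; 24; 333; 170; 299; 382; 79; 99;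
267; 181; 230; 33; 7; 132; 331; 389; 229; 73; 157; 394; 56; 376; 175; 62; 184; 263; 12;
39; 324; 231; 379; 260; 183; 346; 86; 176; 377; 275; 357; 339; 314; 172; 202; 302; 108;
300; 125; 101; 43; 364; 321; 388; 112; 269; 68; 371; 49; 149; 171; 120; 278; 47; 3; 268;
206; 365; 348; 262; 102; 195; 131; 380; 20; 385; 248; 279; 199; 306; 135; 63; 239; 23;
205; 387; 90; 104; 322; 1; 111; 10; 105; 110; 222; 91; 272; 67; 34; 318; 366; 390; 251;
133; 266; 237; 370; 196; 285; 210; 169; 92; 395; 313; 258; 37; 234; 280; 83; 226; 82; 54;
188; 46]%num);
  (135, 3, 46, [::
137; 264; 349; 292; 1; 117; 127; 178; 194; 138; 24; 51; 39; 177; 393; 355; 201; 232; 204;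
219; 12; 198; 283; 240; 143; 311; 313; 398; 207; 169; 133; 260; 341; 88; 102; 140; 331;
183; 245; 26; 141; 252; 243; 317; 291; 159; 189; 146; 346; 307; 72; 217; 17; 310; 84; 107;
390; 336; 92; 309; 206; 299; 94; 282; 300; 247; 23; 312; 314; 5; 48; 19; 29; 208; 9; 163;
214; 22; 402; 4; 295; 236; 306; 155; 148; 13; 367; 32; 271; 168; 129; 298; 174; 90; 8;
213; 316; 362; 45; 320; 329; 171; 250; 364; 42; 130; 162; 227; 122; 256; 113; 345; 385;
330; 197; 2; 34; 275; 222; 347; 324; 82; 152; 375; 383; 74; 83; 190; 123; 212; 27; 195;
77; 279; 352; 339; 388; 301; 10; 237; 38; 116; 25; 21; 67; 3; 193; 266; 380; 44; 118; 98;
272; 304; 153; 181; 344; 180; 268; 132; 188; 386; 62; 166; 95; 68; 35; 281; 269; 120; 370;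
170; 30; 131; 50; 366; 182; 16; 93; 229; 31; 158; 191; 293; 145; 192; 350; 20; 33; 333;
328; 337; 167; 126; 176; 73; 186; 49; 231; 61; 395; 368; 66; 115; 111; 54; 244; 99; 106;
321; 376; 220; 156; 289; 294; 37; 6; 238; 325; 210; 154; 79; 224; 290; 384; 223; 89; 369;
215; 230; 285; 365; 382; 142; 86; 161; 394; 65; 288; 11; 296; 326; 340; 165; 278; 139;
360; 372; 391; 157; 179; 234; 85; 36; 125; 200; 187; 14; 235; 216; 246; 334; 276; 315; 87;
356; 175; 286; 280; 327; 373; 270; 359; 81; 343; 248; 134; 172; 242; 381; 151; 97; 287;
351; 147; 135; 184; 112; 202; 221; 209; 144; 211; 185; 7; 101; 150; 63; 378; 164; 403;
100; 241; 267; 338; 55; 124; 78; 70; 254; 274; 361; 302; 173; 374; 353; 203; 258; 239;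
392; 251; 342; 225; 396; 128; 257; 109; 303; 53; 64; 218; 332; 348; 59; 277; 322; 255; 43;
261; 136; 318; 76; 57; 404; 205; 47; 265; 249; 273; 401; 259; 69; 105; 399; 377; 263; 104;
199; 262; 96; 103; 335; 41; 319; 389; 297; 284; 60; 196; 80; 305; 52; 233; 18; 15; 40;
363; 91; 323; 28; 357; 400; 379; 387; 253; 56; 71; 110; 119; 75; 58; 46; 114; 371; 308;
160; 108; 228; 226; 397; 121; 149; 358; 354]%num);
  (139, 3, 42, [::
6; 47; 93; 1; 22; 275; 185; 41; 150; 326; 19; 84; 103; 279; 120; 158; 333; 165; 294; 230;
138; 159; 49; 147; 71; 404; 381; 258; 139; 91; 183; 386; 31; 338; 387; 155; 369; 358; 257;
21; 117; 405; 82; 184; 349; 132; 170; 8; 391; 176; 291; 90; 89; 373; 228; 352; 337; 191;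
141; 353; 335; 94; 199; 124; 342; 171; 189; 85; 207; 13; 289; 136; 304; 370; 306; 218;
219; 383; 299; 17; 118; 42; 394; 45; 330; 393; 341; 50; 265; 113; 244; 321; 364; 46; 246;
367; 14; 325; 235; 243; 195; 327; 350; 192; 181; 334; 406; 249; 23; 301; 109; 79; 292;
101; 256; 311; 413; 308; 389; 58; 272; 62; 161; 197; 173; 160; 30; 416; 34; 222; 339; 278;
232; 60; 221; 11; 179; 152; 309; 25; 122; 344; 140; 371; 5; 97; 143; 24; 9; 343; 56; 157;
392; 351; 237; 126; 100; 156; 193; 201; 7; 286; 142; 266; 154; 145; 281; 78; 61; 385; 285;
55; 114; 377; 297; 407; 248; 261; 112; 18; 216; 52; 363; 245; 307; 116; 253; 108; 73; 182;
196; 57; 43; 293; 167; 168; 66; 270; 127; 284; 400; 211; 214; 316; 48; 415; 366; 128; 144;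
378; 345; 263; 318; 115; 234; 53; 32; 224; 162; 238; 35; 336; 310; 29; 320; 280; 322; 137;
190; 107; 412; 403; 27; 28; 96; 205; 70; 241; 80; 302; 259; 388; 313; 4; 380; 37; 361; 87;
74; 88; 252; 209; 324; 172; 346; 225; 146; 315; 67; 354; 99; 359; 271; 213; 220; 239; 174;
365; 231; 65; 83; 121; 39; 229; 72; 236; 186; 202; 267; 319; 379; 200; 268; 398; 395; 355;
287; 242; 20; 10; 396; 368; 59; 81; 317; 106; 303; 357; 329; 163; 64; 63; 227; 312; 86;
95; 44; 125; 362; 240; 187; 203; 328; 110; 375; 282; 123; 98; 250; 276; 223; 135; 148; 12;
409; 15; 215; 3; 323; 274; 300; 264; 130; 206; 68; 102; 233; 178; 175; 105; 372; 348; 77;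
408; 204; 314; 360; 54; 69; 376; 153; 180; 51; 164; 305; 273; 38; 119; 277; 295; 194; 166;
149; 254; 255; 410; 374; 76; 401; 397; 169; 298; 36; 283; 92; 340; 226; 198; 151; 411; 26;
382; 177; 104; 188; 251; 331; 414; 133; 210; 75; 247; 399; 390; 332; 33; 217; 2; 269; 290;
212; 208; 131; 384; 129; 111; 260; 40; 262; 356; 288; 347; 134; 16; 296; 402]%num);
  (143, 3, 100, [::
412; 274; 152; 353; 419; 145; 21; 4; 340; 141; 389; 125; 210; 335; 386; 225; 294; 98; 422;
162; 332; 390; 402; 165; 206; 246; 174; 29; 84; 106; 291; 426; 322; 293; 371; 418; 7; 406;
56; 393; 245; 326; 300; 254; 157; 167; 182; 373; 57; 222; 175; 295; 374; 103; 196; 105;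
176; 38; 391; 220; 266; 269; 308; 296; 131; 203; 137; 376; 382; 151; 90; 9; 117; 207; 1;
214; 58; 411; 127; 248; 158; 99; 414; 102; 305; 197; 271; 189; 252; 184; 65; 123; 143; 39;
215; 148; 28; 140; 5; 236; 79; 289; 232; 228; 198; 235; 144; 349; 55; 242; 37; 118; 52;
417; 364; 256; 18; 255; 221; 375; 392; 410; 378; 368; 146; 223; 302; 60; 303; 48; 83; 372;
114; 240; 109; 93; 356; 75; 407; 234; 191; 325; 396; 153; 66; 47; 321; 149; 241; 147; 338;
159; 327; 218; 63; 204; 318; 330; 185; 387; 44; 400; 264; 313; 282; 24; 227; 377; 358;
380; 32; 62; 337; 307; 367; 42; 209; 231; 95; 309; 154; 126; 31; 408; 112; 16; 265; 261;
160; 298; 101; 229; 49; 381; 362; 420; 86; 12; 20; 297; 379; 19; 243; 59; 350; 161; 384;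
262; 370; 276; 15; 404; 413; 306; 339; 360; 278; 178; 424; 142; 268; 192; 136; 290; 35;
347; 409; 319; 257; 224; 328; 91; 107; 14; 251; 40; 421; 11; 361; 180; 53; 77; 341; 89;
36; 183; 119; 352; 46; 273; 401; 71; 138; 188; 415; 26; 299; 133; 23; 73; 132; 427; 216;
72; 199; 94; 92; 285; 124; 263; 355; 351; 13; 201; 403; 78; 128; 100; 164; 186; 286; 346;
113; 173; 96; 61; 115; 190; 416; 310; 81; 170; 87; 33; 219; 315; 121; 150; 329; 323; 181;
316; 301; 25; 283; 82; 2; 120; 211; 17; 331; 10; 342; 187; 226; 237; 169; 397; 244; 195;
250; 110; 344; 193; 423; 270; 166; 116; 280; 6; 317; 324; 45; 74; 304; 172; 163; 122; 394;
156; 171; 67; 3; 130; 365; 200; 259; 284; 239; 320; 405; 345; 212; 383; 334; 292; 129;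
385; 177; 208; 41; 85; 247; 311; 281; 76; 398; 22; 253; 369; 194; 388; 213; 275; 312; 155;
64; 395; 202; 348; 357; 27; 68; 363; 88; 135; 314; 43; 80; 258; 343; 30; 260; 70; 134; 97;
34; 399; 333; 168; 359; 267; 54; 179; 217; 50; 205; 233; 108; 425; 287; 69; 272; 354; 288;
139; 8; 428; 279; 51; 238; 277; 366; 249; 230; 104; 336; 111]%num);
  (147, 3, 67, [::
161; 56; 143; 314; 89; 231; 311; 65; 286; 346; 236; 380; 183; 44; 101; 73; 315; 283; 262;
15; 34; 78; 418; 212; 267; 438; 26; 258; 29; 8; 134; 250; 439; 334; 413; 411; 149; 197;
345; 257; 35; 106; 406; 86; 168; 431; 421; 219; 341; 287; 137; 105; 436; 326; 426; 415;
181; 408; 251; 399; 167; 70; 261; 145; 386; 365; 375; 55; 318; 228; 410; 207; 237; 304;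
179; 20; 13; 276; 11; 309; 87; 369; 321; 303; 114; 146; 189; 213; 158; 88; 298; 388; 22;
220; 382; 160; 187; 75; 19; 49; 285; 371; 17; 338; 177; 155; 376; 356; 385; 98; 196; 173;
166; 323; 405; 216; 71; 316; 41; 241; 16; 129; 12; 383; 39; 82; 222; 68; 336; 97; 50; 40;
123; 83; 254; 224; 127; 36; 104; 57; 390; 203; 193; 77; 111; 185; 367; 284; 52; 347; 2;
53; 409; 31; 170; 154; 363; 384; 301; 184; 381; 186; 271; 46; 100; 244; 232; 351; 422;
157; 424; 299; 227; 352; 163; 108; 206; 330; 225; 96; 419; 378; 259; 112; 116; 156; 404;
165; 72; 67; 416; 130; 148; 99; 235; 434; 178; 81; 3; 273; 230; 256; 141; 333; 292; 64;
358; 264; 432; 417; 325; 14; 192; 7; 84; 9; 373; 147; 368; 6; 302; 102; 162; 202; 255;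
339; 293; 359; 397; 90; 240; 211; 324; 23; 253; 38; 118; 223; 394; 370; 362; 277; 24; 138;
280; 92; 331; 188; 110; 272; 218; 174; 260; 296; 136; 320; 270; 344; 85; 290; 328; 437;
217; 124; 142; 152; 51; 119; 430; 30; 387; 278; 115; 307; 392; 229; 234; 58; 59; 135; 159;
313; 32; 263; 131; 396; 10; 412; 113; 357; 79; 172; 243; 153; 91; 266; 80; 275; 374; 120;
348; 337; 117; 429; 208; 372; 215; 4; 423; 171; 27; 43; 126; 310; 420; 322; 317; 300; 377;
204; 210; 265; 180; 252; 268; 274; 433; 398; 190; 238; 95; 247; 37; 164; 428; 121; 389;
151; 355; 327; 109; 214; 182; 122; 249; 45; 69; 200; 282; 308; 47; 66; 60; 354; 403; 150;
435; 295; 140; 175; 239; 425; 42; 379; 391; 199; 306; 76; 133; 401; 291; 395; 198; 139;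
209; 195; 242; 176; 191; 335; 440; 221; 279; 269; 281; 427; 349; 312; 294; 54; 103; 94;
62; 400; 329; 288; 332; 343; 128; 361; 353; 360; 21; 132; 28; 93; 169; 201; 144; 1; 366;
407; 194; 63; 393; 226; 25; 18; 402; 350; 48; 248; 289; 5; 342; 319; 305; 340; 205; 297;
364; 245; 125; 33; 233; 74; 107; 61; 414; 246]%num);
  (151, 3, 32, [::
29; 364; 320; 266; 115; 391; 120; 8; 433; 436; 150; 422; 189; 59; 118; 110; 388; 22; 2;
415; 168; 4; 76; 405; 411; 130; 416; 275; 358; 235; 194; 421; 149; 217; 176; 70; 184; 431;
412; 69; 259; 162; 258; 193; 158; 186; 156; 218; 375; 330; 401; 395; 53; 406; 278; 351;
173; 301; 177; 68; 6; 273; 325; 347; 15; 365; 112; 67; 148; 44; 165; 294; 3; 238; 36; 21;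
34; 243; 329; 183; 167; 366; 164; 271; 237; 322; 394; 50; 142; 47; 206; 442; 355; 7; 440;
56; 225; 74; 407; 65; 178; 14; 292; 199; 231; 414; 223; 236; 327; 125; 398; 73; 308; 96;
25; 195; 361; 353; 333; 288; 202; 434; 306; 234; 399; 305; 105; 153; 245; 316; 315; 368;
441; 61; 93; 263; 97; 296; 224; 212; 154; 313; 79; 172; 94; 28; 367; 420; 419; 298; 159;
284; 16; 328; 247; 372; 244; 409; 82; 380; 300; 11; 374; 341; 83; 324; 276; 336; 426; 30;
352; 326; 429; 404; 428; 81; 279; 359; 187; 215; 335; 84; 250; 256; 299; 268; 381; 213;
338; 135; 166; 42; 450; 89; 228; 430; 410; 254; 106; 246; 133; 211; 117; 423; 13; 126;
221; 262; 229; 230; 249; 33; 343; 52; 435; 438; 143; 147; 403; 111; 80; 319; 408; 141; 43;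
437; 387; 123; 362; 146; 108; 107; 277; 285; 200; 175; 413; 27; 181; 95; 219; 290; 209;
49; 302; 103; 260; 267; 88; 400; 188; 291; 86; 382; 182; 100; 345; 425; 128; 427; 48; 303;
334; 171; 390; 349; 45; 179; 60; 144; 389; 127; 104; 37; 265; 210; 64; 293; 40; 331; 392;
360; 132; 155; 91; 75; 10; 270; 280; 346; 185; 337; 287; 17; 227; 449; 41; 439; 38; 257;
31; 57; 255; 119; 289; 369; 272; 445; 190; 161; 113; 23; 310; 174; 87; 140; 196; 311; 417;
62; 385; 66; 98; 207; 396; 340; 269; 220; 102; 191; 383; 160; 348; 122; 274; 373; 208;
354; 370; 248; 282; 402; 350; 232; 295; 5; 129; 58; 447; 139; 163; 371; 170; 35; 136; 332;
1; 180; 192; 342; 384; 281; 19; 376; 145; 109; 124; 198; 72; 54; 357; 116; 317; 251; 321;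
55; 283; 101; 46; 71; 253; 444; 205; 443; 92; 424; 114; 9; 314; 203; 201; 297; 446; 197;
242; 318; 99; 18; 378; 344; 204; 121; 20; 151; 241; 304; 264; 393; 24; 157; 90; 137; 432;
379; 448; 12; 397; 85; 309; 78; 312; 131; 32; 286; 134; 252; 26; 323; 233; 216; 240; 138;
386; 152; 377; 307; 169; 363; 77; 356; 452; 63; 222; 226; 39; 239; 339; 418; 451; 51; 214;
261]%num);
  (153, 3, 52, [::
178; 12; 426; 283; 112; 106; 139; 88; 342; 153; 216; 144; 207; 189; 109; 46; 276; 85; 280;
158; 176; 242; 73; 209; 105; 368; 436; 240; 154; 4; 8; 41; 337; 200; 434; 103; 194; 348;
313; 327; 37; 3; 64; 217; 26; 407; 28; 18; 447; 201; 376; 443; 76; 255; 400; 168; 72; 346;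
193; 353; 359; 453; 333; 218; 96; 150; 417; 365; 185; 405; 82; 1; 235; 225; 174; 84; 205;
202; 339; 36; 146; 277; 87; 188; 118; 362; 43; 75; 301; 273; 375; 383; 228; 27; 296; 357;
403; 439; 380; 166; 431; 457; 47; 286; 172; 394; 391; 416; 345; 249; 94; 57; 360; 19; 409;
261; 30; 297; 93; 314; 161; 366; 379; 241; 335; 132; 300; 17; 133; 24; 372; 140; 220; 388;
63; 306; 260; 99; 448; 322; 311; 61; 187; 89; 413; 70; 97; 66; 419; 401; 452; 455; 254;
164; 397; 355; 396; 450; 53; 239; 243; 79; 9; 433; 173; 298; 268; 35; 299; 32; 165; 38;
78; 184; 423; 29; 175; 181; 265; 374; 404; 244; 279; 262; 23; 15; 267; 393; 316; 284; 312;
152; 275; 422; 192; 11; 147; 234; 227; 141; 390; 271; 378; 67; 33; 80; 212; 282; 83; 204;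
437; 198; 310; 143; 364; 98; 215; 331; 444; 278; 135; 191; 129; 211; 114; 145; 341; 295;
274; 91; 429; 25; 7; 418; 199; 60; 31; 2; 264; 292; 427; 77; 449; 338; 120; 169; 392; 356;
124; 69; 285; 384; 108; 170; 224; 406; 221; 323; 156; 349; 347; 305; 213; 159; 454; 50;
398; 288; 451; 134; 51; 219; 377; 308; 382; 381; 441; 113; 358; 95; 270; 237; 137; 291;
107; 203; 45; 110; 10; 125; 325; 287; 52; 92; 86; 179; 162; 238; 304; 81; 123; 115; 428;
332; 20; 343; 351; 148; 440; 160; 210; 65; 21; 334; 458; 307; 253; 233; 142; 251; 116; 54;
177; 371; 163; 408; 59; 266; 410; 138; 411; 246; 385; 104; 186; 319; 309; 119; 350; 293;
226; 14; 303; 256; 370; 6; 269; 56; 127; 324; 100; 424; 387; 68; 395; 131; 44; 435; 122;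
294; 71; 16; 231; 136; 230; 196; 183; 421; 149; 180; 352; 336; 272; 151; 326; 446; 263;
190; 363; 74; 5; 420; 250; 414; 245; 252; 42; 367; 171; 197; 121; 155; 22; 229; 281; 399;
415; 354; 344; 101; 402; 456; 130; 206; 302; 248; 208; 257; 289; 90; 222; 373; 34; 236;
102; 182; 223; 321; 290; 128; 317; 195; 438; 214; 111; 329; 386; 117; 445; 167; 49; 13;
40; 48; 259; 369; 232; 330; 126; 315; 425; 389; 432; 62; 58; 318; 247; 442; 55; 412; 361;
430; 340; 157; 328; 320; 258; 39]%num);
  (155, 3, 36, [::
401; 5; 457; 287; 249; 437; 415; 322; 38; 260; 406; 267; 64; 447; 55; 10; 389; 424; 428;
299; 103; 135; 190; 87; 229; 342; 256; 463; 394; 380; 409; 269; 264; 96; 130; 458; 398;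
199; 207; 277; 408; 184; 306; 407; 296; 328; 307; 116; 271; 289; 154; 440; 436; 210; 226;
83; 45; 162; 34; 438; 295; 189; 205; 352; 181; 291; 234; 100; 252; 371; 206; 288; 456;
314; 77; 51; 63; 304; 265; 174; 32; 89; 400; 464; 255; 257; 214; 230; 319; 454; 33; 165;
282; 163; 36; 67; 164; 149; 151; 318; 385; 65; 372; 251; 215; 129; 123; 360; 410; 399;
213; 222; 188; 140; 43; 4; 21; 384; 242; 350; 81; 106; 139; 104; 417; 1; 19; 160; 351; 31;
137; 460; 365; 344; 195; 254; 127; 179; 402; 182; 115; 112; 313; 218; 208; 156; 253; 336;
15; 122; 345; 378; 347; 198; 57; 448; 60; 202; 186; 369; 232; 62; 243; 111; 358; 136; 109;
80; 158; 339; 397; 366; 117; 427; 459; 3; 44; 416; 187; 18; 326; 395; 132; 356; 22; 209;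
191; 157; 418; 338; 404; 450; 27; 244; 221; 176; 403; 196; 443; 120; 284; 102; 152; 193;
78; 125; 377; 321; 376; 46; 99; 330; 216; 84; 192; 346; 28; 220; 266; 429; 105; 340; 173;
324; 56; 310; 26; 292; 442; 349; 334; 446; 316; 278; 76; 329; 113; 25; 413; 375; 227; 430;
228; 200; 355; 194; 185; 276; 301; 392; 72; 128; 449; 180; 359; 54; 42; 168; 309; 41; 423;
275; 94; 305; 273; 461; 279; 258; 124; 71; 172; 435; 68; 35; 177; 432; 108; 419; 13; 101;
161; 212; 11; 248; 462; 203; 204; 233; 12; 320; 236; 144; 183; 75; 270; 79; 24; 59; 37;
245; 133; 66; 201; 85; 178; 433; 337; 119; 312; 17; 145; 357; 315; 166; 343; 422; 293;
327; 274; 138; 170; 383; 82; 39; 411; 379; 97; 217; 425; 298; 302; 98; 453; 250; 421; 285;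
412; 153; 7; 386; 390; 297; 261; 53; 159; 426; 247; 23; 48; 121; 286; 95; 114; 134; 311;
30; 241; 300; 332; 93; 47; 382; 171; 325; 434; 262; 239; 353; 8; 175; 272; 50; 420; 2; 90;
69; 280; 74; 91; 20; 52; 431; 303; 131; 452; 29; 107; 73; 290; 167; 444; 396; 225; 370;
363; 155; 445; 393; 61; 381; 362; 323; 317; 211; 335; 373; 235; 86; 259; 405; 219; 16;
388; 246; 368; 331; 441; 88; 70; 146; 143; 283; 169; 354; 197; 391; 451; 268; 92; 118;
374; 224; 147; 231; 439; 387; 414; 6; 367; 361; 141; 294; 364; 237; 223; 40; 240; 126;
341; 308; 455; 348; 150; 333; 148; 142; 58; 263; 9; 281; 14; 238; 49; 110]%num);
  (157, 3, 12, [::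
229; 452; 22; 412; 421; 405; 328; 47; 440; 63; 212; 31; 64; 174; 258; 353; 266; 60; 213;
465; 224; 358; 311; 456; 438; 294; 298; 348; 13; 192; 89; 182; 164; 78; 256; 102; 9; 280;
88; 177; 306; 307; 32; 288; 356; 165; 210; 105; 418; 396; 234; 146; 138; 273; 101; 442;
462; 308; 36; 270; 108; 39; 355; 95; 144; 390; 391; 436; 79; 134; 126; 244; 275; 215; 289;
402; 26; 286; 365; 310; 312; 61; 296; 361; 50; 33; 125; 111; 395; 11; 392; 374; 368; 48;
198; 135; 403; 204; 37; 417; 199; 464; 439; 167; 340; 183; 422; 148; 408; 207; 367; 297;
274; 45; 359; 218; 419; 114; 3; 195; 123; 248; 145; 338; 184; 302; 455; 140; 40; 153; 150;
410; 76; 269; 246; 143; 343; 459; 381; 80; 170; 304; 399; 400; 41; 237; 295; 335; 100;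
112; 236; 130; 72; 415; 351; 219; 92; 458; 49; 178; 283; 345; 398; 228; 46; 206; 277; 163;
429; 69; 257; 155; 331; 285; 369; 158; 238; 300; 217; 35; 427; 346; 378; 352; 194; 449;
29; 414; 272; 169; 362; 299; 109; 371; 460; 271; 309; 197; 233; 376; 384; 73; 336; 23; 5;
25; 313; 323; 85; 98; 264; 341; 128; 203; 74; 15; 139; 357; 157; 450; 94; 55; 17; 411; 4;
166; 437; 30; 151; 293; 250; 407; 118; 240; 316; 301; 363; 34; 7; 339; 121; 242; 406; 420;
262; 337; 67; 364; 211; 172; 24; 434; 315; 324; 252; 59; 329; 282; 278; 330; 8; 397; 129;
231; 388; 175; 70; 187; 28; 191; 260; 281; 168; 190; 467; 350; 332; 18; 113; 119; 287; 93;
75; 27; 470; 251; 38; 383; 12; 319; 226; 99; 320; 463; 124; 149; 201; 43; 259; 389; 321;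
377; 327; 354; 235; 90; 21; 230; 342; 188; 1; 435; 117; 220; 322; 279; 160; 115; 370; 180;
96; 245; 444; 186; 221; 382; 241; 56; 254; 131; 349; 446; 457; 66; 82; 249; 154; 10; 276;
393; 189; 71; 326; 222; 426; 386; 156; 107; 239; 385; 379; 83; 268; 103; 263; 86; 454;
193; 91; 404; 380; 2; 202; 347; 372; 179; 54; 433; 120; 469; 152; 447; 205; 292; 451; 430;
173; 443; 84; 303; 468; 334; 291; 200; 162; 267; 122; 53; 19; 127; 137; 448; 159; 77; 366;
110; 171; 261; 161; 290; 441; 243; 247; 401; 208; 227; 425; 116; 333; 14; 317; 58; 432;
42; 196; 51; 423; 223; 106; 413; 142; 305; 253; 314; 214; 16; 209; 461; 284; 265; 44; 65;
68; 360; 216; 344; 97; 6; 176; 424; 232; 428; 255; 133; 409; 416; 325; 132; 136; 57; 453;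
81; 318; 387; 185; 375; 225; 394; 104; 52; 466; 62; 147; 431; 87; 445; 141; 373; 20; 181]%num);
  (161, 3, 93, [::
418; 227; 117; 179; 379; 119; 351; 373; 157; 287; 325; 98; 273; 276; 321; 238; 317; 62;
453; 337; 436; 334; 198; 318; 6; 69; 196; 216; 88; 429; 156; 175; 110; 285; 378; 409; 298;
164; 89; 47; 376; 103; 264; 5; 370; 251; 197; 445; 14; 266; 207; 440; 246; 26; 433; 425;
399; 96; 71; 23; 210; 421; 263; 398; 152; 165; 469; 121; 329; 322; 141; 43; 59; 234; 120;
148; 111; 275; 299; 468; 272; 277; 93; 159; 482; 8; 219; 404; 291; 301; 217; 48; 115; 441;
91; 357; 135; 286; 450; 267; 76; 431; 85; 279; 252; 260; 390; 80; 232; 311; 208; 434; 125;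
458; 375; 323; 462; 67; 195; 395; 471; 57; 397; 233; 107; 328; 368; 284; 451; 303; 362;
205; 70; 236; 31; 181; 209; 143; 20; 410; 162; 352; 478; 439; 202; 134; 237; 240; 172;
193; 158; 230; 413; 257; 122; 183; 391; 333; 452; 309; 72; 99; 320; 326; 415; 270; 242;
95; 332; 381; 300; 380; 228; 235; 222; 407; 102; 54; 262; 463; 289; 92; 86; 348; 283; 344;
449; 456; 39; 388; 477; 214; 42; 419; 30; 457; 422; 374; 18; 401; 336; 33; 28; 239; 411;
45; 314; 231; 22; 459; 396; 369; 155; 358; 349; 474; 24; 149; 212; 383; 269; 161; 185;
218; 131; 73; 194; 109; 280; 87; 118; 32; 331; 476; 94; 10; 184; 424; 247; 417; 112; 430;
475; 448; 253; 347; 480; 292; 416; 4; 153; 412; 405; 366; 372; 126; 305; 386; 385; 186;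
150; 188; 64; 124; 460; 105; 192; 467; 250; 130; 377; 394; 294; 129; 259; 353; 66; 104;
229; 255; 77; 356; 151; 278; 15; 106; 470; 133; 180; 113; 316; 324; 223; 2; 426; 38; 481;
330; 408; 307; 27; 271; 142; 464; 201; 154; 473; 339; 17; 101; 288; 350; 435; 258; 315;
365; 327; 213; 420; 200; 12; 178; 21; 261; 68; 392; 367; 116; 454; 319; 382; 438; 268; 16;
137; 82; 241; 60; 176; 249; 225; 90; 61; 423; 163; 174; 136; 215; 173; 127; 168; 472; 46;
355; 335; 190; 220; 204; 52; 206; 281; 83; 177; 211; 364; 359; 138; 400; 466; 354; 53; 25;
343; 145; 199; 79; 402; 37; 35; 446; 221; 160; 65; 274; 295; 29; 11; 432; 338; 139; 254;
243; 393; 187; 447; 9; 479; 224; 100; 226; 81; 360; 427; 444; 290; 428; 465; 55; 455; 36;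
171; 128; 3; 40; 7; 342; 387; 244; 34; 58; 19; 123; 166; 1; 302; 341; 443; 63; 403; 13;
78; 361; 114; 140; 170; 56; 384; 147; 313; 144; 297; 304; 75; 282; 132; 371; 414; 44; 41;
49; 346; 146; 363; 256; 245; 265; 169; 167; 248; 293; 51; 50; 296; 97; 306; 312; 437; 191;
442; 340; 74; 182; 345; 108; 310; 406; 189; 203; 308; 84; 461; 389]%num);
  (163, 3, 58, [::
11; 221; 480; 90; 145; 111; 379; 119; 482; 2; 33; 49; 172; 68; 432; 304; 1; 246; 76; 367;
416; 261; 235; 88; 321; 271; 17; 475; 212; 99; 316; 74; 291; 446; 222; 232; 292; 479; 67;
100; 250; 296; 354; 399; 163; 362; 349; 83; 473; 299; 123; 230; 374; 417; 153; 318; 192;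
411; 443; 16; 433; 110; 386; 422; 201; 420; 346; 303; 403; 47; 442; 419; 351; 28; 31; 252;
173; 376; 370; 4; 307; 474; 297; 206; 449; 404; 21; 116; 156; 184; 389; 276; 391; 142;
356; 285; 392; 455; 319; 42; 350; 179; 148; 159; 86; 247; 19; 171; 427; 113; 223; 274;
426; 255; 398; 284; 78; 334; 220; 400; 167; 190; 260; 320; 311; 405; 18; 360; 115; 458;
330; 397; 283; 371; 282; 406; 300; 72; 342; 225; 451; 140; 450; 279; 158; 388; 14; 137;
387; 293; 415; 209; 121; 390; 460; 381; 38; 273; 313; 236; 256; 430; 65; 195; 130; 218;
207; 168; 456; 237; 243; 22; 365; 366; 15; 312; 326; 58; 150; 43; 107; 30; 50; 429; 280;
114; 258; 63; 364; 176; 94; 461; 361; 40; 71; 108; 39; 396; 329; 191; 423; 136; 487; 32;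
7; 270; 196; 157; 135; 202; 435; 287; 13; 337; 34; 216; 468; 217; 437; 97; 132; 37; 128;
441; 340; 242; 302; 200; 129; 317; 177; 338; 352; 412; 180; 8; 345; 93; 309; 187; 12; 105;
382; 248; 253; 238; 327; 45; 118; 161; 194; 254; 414; 35; 193; 109; 170; 226; 239; 169;
488; 211; 264; 310; 281; 55; 331; 219; 36; 288; 357; 151; 139; 355; 5; 453; 476; 269; 359;
314; 41; 485; 104; 66; 380; 378; 348; 174; 306; 213; 154; 6; 117; 96; 452; 205; 278; 52;
294; 347; 60; 26; 120; 79; 363; 375; 155; 23; 463; 73; 369; 447; 465; 289; 181; 122; 257;
234; 467; 445; 54; 251; 95; 141; 275; 87; 244; 295; 384; 407; 240; 286; 462; 373; 408; 46;
197; 134; 164; 457; 106; 454; 210; 62; 229; 245; 70; 267; 469; 385; 431; 444; 85; 44; 143;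
332; 324; 333; 84; 434; 322; 402; 131; 298; 472; 231; 301; 182; 315; 61; 204; 263; 133;
233; 160; 27; 277; 24; 147; 53; 189; 448; 395; 268; 372; 228; 401; 208; 185; 75; 339; 48;
410; 165; 127; 3; 343; 413; 138; 20; 471; 290; 149; 81; 162; 215; 57; 486; 186; 56; 477;
101; 125; 377; 368; 344; 328; 272; 198; 325; 249; 51; 69; 464; 439; 146; 266; 91; 241;
481; 224; 89; 438; 82; 183; 144; 188; 305; 335; 112; 478; 425; 124; 64; 166; 103; 102; 59;
10; 175; 409; 353; 418; 152; 227; 262; 358; 203; 440; 421; 77; 126; 92; 178; 341; 29; 383;
336; 393; 470; 436; 323; 483; 459; 265; 199; 98; 428; 308; 9; 484; 80; 424; 25; 214; 394;
466; 259]%num);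
  (99, 5, 37, [::
403; 492; 54; 156; 301; 60; 257; 466; 91; 439; 315; 63; 123; 382; 258; 110; 8; 312; 248;
292; 187; 64; 204; 32; 94; 349; 5; 86; 280; 322; 445; 130; 77; 262; 148; 44; 350; 162; 26;
10; 75; 198; 400; 142; 372; 223; 480; 398; 455; 131; 318; 228; 23; 476; 83; 215; 222; 88;
126; 323; 87; 102; 387; 21; 380; 70; 423; 329; 234; 451; 391; 314; 348; 151; 431; 56; 109;
405; 17; 2; 335; 278; 256; 243; 239; 113; 241; 490; 275; 279; 450; 85; 321; 59; 195; 452;
324; 471; 140; 295; 249; 125; 298; 168; 446; 65; 477; 432; 190; 364; 420; 416; 39; 489;
174; 290; 202; 136; 6; 437; 226; 92; 104; 201; 141; 20; 135; 385; 388; 206; 317; 176; 440;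
376; 419; 115; 260; 42; 217; 351; 269; 103; 170; 253; 108; 325; 332; 307; 246; 238; 164;
100; 375; 49; 347; 457; 225; 331; 426; 69; 442; 482; 395; 114; 310; 252; 240; 128; 121;
173; 326; 16; 196; 264; 410; 197; 334; 444; 13; 378; 303; 300; 36; 464; 101; 105; 263;
399; 122; 339; 52; 129; 203; 230; 175; 293; 24; 282; 38; 453; 205; 200; 216; 236; 268;
224; 3; 358; 9; 487; 211; 270; 488; 456; 193; 369; 247; 418; 470; 428; 214; 35; 443; 288;
48; 377; 165; 344; 383; 271; 276; 210; 251; 338; 58; 485; 361; 90; 18; 50; 55; 296; 81;
254; 328; 185; 327; 341; 424; 486; 459; 311; 209; 179; 356; 386; 161; 463; 152; 284; 181;
79; 272; 57; 340; 479; 25; 43; 112; 159; 414; 191; 11; 436; 454; 297; 169; 472; 367; 4;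
78; 53; 12; 352; 273; 469; 309; 208; 435; 447; 359; 66; 84; 363; 31; 304; 430; 337; 494;
30; 285; 68; 235; 379; 177; 330; 371; 184; 333; 15; 229; 29; 422; 154; 22; 67; 299; 221;
74; 194; 320; 213; 407; 427; 433; 265; 374; 441; 401; 166; 421; 99; 286; 72; 289; 41; 132;
137; 484; 274; 233; 183; 393; 93; 119; 33; 468; 267; 242; 406; 458; 82; 261; 218; 118;
219; 155; 415; 46; 478; 133; 370; 353; 389; 180; 474; 116; 232; 14; 475; 277; 283; 355;
127; 294; 145; 95; 237; 34; 212; 189; 245; 461; 287; 244; 255; 73; 362; 319; 409; 381;
308; 96; 178; 467; 412; 76; 397; 28; 396; 384; 160; 343; 80; 357; 302; 483; 360; 434; 413;
143; 47; 411; 481; 493; 199; 37; 186; 144; 157; 390; 61; 342; 227; 438; 291; 220; 7; 259;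
98; 336; 147; 111; 182; 192; 107; 231; 163; 146; 346; 460; 429; 425; 316; 354; 27; 19;
462; 306; 373; 117; 89; 158; 207; 417; 51; 106; 149; 1; 167; 188; 313; 366; 392; 138; 120;
365; 62; 45; 139; 394; 305; 153; 150; 402; 281; 473; 408; 404; 250; 491; 71; 368; 266; 40;
172; 465; 449; 448; 171; 97; 124; 345; 134]%num);
  (71, 7, 20, [::
191; 17; 150; 362; 97; 74; 443; 214; 306; 432; 175; 420; 140; 83; 336; 435; 410; 106; 235;
181; 282; 2; 37; 26; 276; 225; 349; 465; 193; 270; 111; 247; 12; 59; 221; 163; 314; 109;
158; 104; 243; 204; 447; 491; 198; 53; 62; 93; 350; 264; 165; 28; 429; 41; 266; 129; 396;
114; 3; 373; 179; 269; 405; 466; 374; 423; 177; 421; 23; 206; 265; 167; 237; 416; 209;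
229; 60; 391; 200; 488; 258; 138; 103; 475; 245; 331; 358; 20; 408; 171; 151; 492; 313;
354; 244; 71; 341; 152; 388; 48; 139; 473; 285; 213; 196; 185; 118; 34; 234; 448; 496;
201; 360; 377; 456; 298; 55; 157; 4; 10; 353; 401; 263; 136; 418; 212; 312; 18; 164; 252;
36; 395; 482; 345; 438; 310; 368; 422; 287; 463; 326; 335; 437; 231; 323; 22; 144; 453;
487; 91; 317; 400; 153; 217; 444; 192; 321; 477; 363; 343; 249; 13; 85; 208; 182; 16; 35;
220; 329; 125; 398; 478; 242; 127; 381; 351; 262; 72; 337; 468; 116; 307; 108; 186; 170;
143; 78; 156; 415; 268; 273; 424; 67; 474; 159; 89; 95; 284; 38; 68; 47; 371; 404; 344;
253; 197; 467; 80; 407; 146; 383; 293; 223; 32; 328; 352; 180; 411; 135; 172; 300; 433;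
57; 469; 390; 451; 281; 347; 394; 58; 372; 154; 149; 378; 210; 211; 385; 379; 486; 481;
392; 194; 446; 338; 375; 122; 8; 348; 168; 483; 308; 50; 110; 202; 359; 233; 430; 31; 44;
239; 218; 480; 333; 188; 11; 21; 45; 101; 286; 19; 230; 14; 302; 174; 169; 294; 257; 464;
356; 96; 485; 42; 288; 69; 439; 6; 445; 256; 98; 442; 319; 296; 142; 450; 330; 33; 64;
476; 133; 61; 132; 241; 471; 102; 364; 86; 54; 275; 324; 65; 105; 283; 366; 299; 397; 452;
15; 461; 320; 107; 113; 316; 115; 367; 255; 5; 203; 205; 119; 386; 414; 440; 88; 297; 120;
134; 365; 227; 79; 236; 222; 190; 459; 277; 52; 409; 357; 162; 184; 117; 216; 121; 457;
387; 178; 250; 460; 436; 87; 240; 327; 380; 355; 40; 289; 81; 76; 441; 84; 342; 148; 261;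
403; 427; 232; 160; 24; 131; 340; 46; 361; 309; 176; 315; 219; 470; 322; 49; 295; 462;
301; 291; 94; 413; 484; 325; 332; 272; 141; 82; 311; 274; 112; 339; 369; 73; 145; 303;
259; 318; 458; 124; 417; 215; 280; 39; 412; 137; 376; 479; 370; 305; 128; 43; 346; 393;
183; 334; 246; 123; 173; 304; 248; 489; 454; 228; 187; 406; 428; 224; 51; 267; 254; 155;
1; 70; 472; 431; 166; 490; 161; 426; 29; 384; 260; 100; 290; 382; 389; 63; 126; 75; 279;
147; 90; 271; 195; 92; 27; 425; 251; 434; 130; 66; 56; 77; 199; 495; 7; 226; 292; 30; 419;
9; 399; 449; 25; 494; 99; 238; 189; 207; 493; 402; 278; 455]%num);
  (101, 5, 36, [::
283; 243; 141; 348; 70; 164; 246; 2; 184; 498; 328; 37; 341; 115; 42; 482; 30; 323; 476;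
87; 380; 254; 281; 408; 183; 440; 119; 299; 233; 167; 369; 84; 259; 446; 238; 337; 362;
190; 356; 88; 212; 327; 264; 445; 280; 372; 220; 23; 311; 202; 75; 21; 120; 108; 71; 308;
371; 374; 384; 258; 436; 464; 96; 229; 26; 234; 29; 399; 133; 257; 461; 207; 373; 459;
284; 447; 412; 398; 317; 432; 157; 101; 248; 321; 287; 197; 487; 102; 125; 223; 423; 99;
112; 159; 324; 479; 315; 38; 293; 216; 463; 128; 40; 116; 107; 48; 401; 255; 205; 20; 3;
244; 430; 11; 109; 492; 326; 191; 434; 466; 100; 185; 189; 305; 376; 22; 485; 431; 132;
391; 235; 44; 387; 113; 282; 355; 245; 34; 218; 486; 483; 473; 156; 77; 63; 435; 241; 82;
53; 204; 252; 161; 187; 354; 221; 60; 357; 237; 489; 150; 154; 18; 406; 306; 319; 211;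
129; 103; 340; 251; 404; 292; 4; 95; 360; 249; 127; 503; 285; 294; 478; 363; 296; 370;
268; 135; 383; 126; 400; 449; 142; 448; 140; 59; 256; 188; 377; 134; 143; 76; 91; 322;
138; 64; 225; 153; 462; 94; 58; 54; 312; 214; 117; 25; 266; 298; 300; 17; 301; 7; 453; 49;
83; 177; 105; 201; 497; 56; 491; 349; 200; 14; 217; 166; 367; 181; 338; 79; 444; 168; 39;
494; 192; 439; 458; 495; 175; 441; 429; 170; 93; 500; 86; 504; 304; 147; 31; 455; 452; 47;
320; 273; 335; 98; 501; 350; 41; 310; 378; 309; 389; 160; 278; 346; 151; 402; 421; 85;
382; 136; 8; 407; 210; 9; 66; 10; 149; 172; 499; 239; 368; 297; 330; 148; 247; 427; 57;
290; 122; 1; 352; 279; 437; 351; 409; 203; 163; 339; 81; 276; 345; 438; 51; 19; 451; 419;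
169; 496; 62; 261; 481; 450; 61; 422; 302; 50; 415; 314; 334; 215; 425; 46; 231; 303; 366;
277; 471; 386; 490; 137; 375; 65; 289; 295; 307; 393; 242; 343; 270; 271; 67; 502; 179;
347; 118; 152; 208; 417; 288; 219; 89; 353; 74; 291; 145; 55; 472; 460; 228; 392; 121;
457; 333; 361; 226; 213; 13; 325; 162; 385; 465; 424; 331; 232; 420; 114; 158; 227; 442;
111; 124; 381; 240; 110; 365; 397; 97; 414; 272; 104; 90; 364; 344; 313; 68; 178; 139;
236; 428; 224; 467; 230; 36; 253; 27; 480; 405; 199; 411; 332; 43; 69; 176; 144; 359; 388;
433; 426; 475; 394; 396; 395; 260; 390; 262; 222; 123; 206; 72; 209; 316; 336; 410; 342;
180; 286; 194; 470; 318; 5; 165; 80; 182; 379; 477; 443; 263; 73; 15; 198; 403; 131; 456;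
493; 155; 358; 265; 469; 274; 186; 35; 130; 267; 106; 250; 52; 269; 33; 275; 488; 171;
329; 32; 12; 196; 193; 484; 418; 6; 413; 24; 173; 28; 174; 78; 146; 195; 45; 92; 16; 416;
454; 474; 468]%num);
  (169, 3, 22, [::
415; 118; 321; 244; 164; 221; 298; 443; 308; 283; 451; 303; 340; 272; 314; 474; 130; 23;
75; 315; 94; 247; 484; 251; 178; 422; 486; 58; 375; 295; 452; 337; 441; 341; 319; 417;
249; 174; 423; 36; 29; 445; 143; 215; 258; 54; 125; 185; 278; 409; 493; 501; 132; 412;
233; 307; 427; 40; 52; 235; 371; 53; 84; 348; 222; 37; 380; 183; 352; 323; 494; 97; 490;
197; 41; 146; 275; 420; 479; 133; 419; 405; 99; 386; 487; 372; 107; 426; 345; 442; 294;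
243; 495; 229; 477; 292; 276; 189; 257; 410; 10; 167; 77; 287; 301; 436; 87; 103; 206;
149; 39; 200; 145; 2; 127; 28; 78; 468; 365; 378; 265; 131; 293; 413; 195; 362; 404; 465;
483; 199; 382; 334; 363; 236; 239; 211; 305; 209; 14; 350; 59; 464; 361; 237; 55; 16; 34;
273; 288; 35; 212; 79; 81; 325; 498; 202; 269; 22; 328; 76; 355; 356; 473; 105; 351; 213;
254; 169; 389; 268; 208; 228; 472; 398; 70; 262; 156; 33; 5; 56; 180; 310; 296; 392; 444;
430; 38; 381; 216; 437; 481; 502; 397; 266; 182; 160; 478; 277; 113; 224; 488; 330; 263;
342; 500; 151; 102; 280; 491; 187; 256; 90; 31; 497; 331; 391; 274; 311; 207; 245; 429;
388; 264; 433; 271; 157; 367; 24; 285; 119; 51; 92; 462; 407; 134; 435; 96; 12; 27; 246;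
62; 347; 204; 111; 456; 454; 44; 368; 177; 460; 220; 304; 108; 60; 395; 459; 168; 190; 32;
166; 83; 50; 142; 411; 414; 463; 63; 91; 286; 240; 147; 480; 104; 46; 72; 158; 259; 370;
291; 248; 47; 424; 30; 253; 42; 369; 506; 137; 400; 432; 322; 66; 136; 504; 358; 421; 505;
218; 225; 144; 446; 461; 333; 71; 336; 434; 230; 205; 396; 406; 7; 217; 193; 171; 161;
344; 162; 284; 431; 110; 163; 438; 384; 327; 120; 401; 68; 428; 67; 329; 116; 114; 373;
196; 302; 467; 21; 317; 117; 393; 366; 299; 173; 93; 69; 492; 172; 447; 152; 227; 364;
471; 267; 101; 449; 122; 453; 377; 290; 394; 466; 387; 403; 448; 250; 129; 241; 175; 499;
496; 440; 261; 455; 353; 74; 354; 357; 11; 124; 135; 188; 379; 332; 140; 186; 242; 503;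
82; 219; 181; 106; 457; 192; 61; 176; 390; 383; 260; 485; 306; 458; 469; 418; 339; 234;
238; 64; 226; 316; 470; 326; 359; 232; 489; 416; 128; 312; 95; 360; 320; 402; 482; 85; 89;
270; 252; 309; 475; 324; 15; 346; 100; 121; 289; 338; 20; 126; 343; 203; 3; 6; 13; 138;
148; 159; 45; 214; 165; 80; 112; 201; 231; 4; 141; 9; 8; 279; 198; 153; 297; 184; 374; 73;
57; 425; 115; 109; 399; 318; 43; 139; 26; 150; 65; 86; 223; 17; 210; 191; 155; 408; 450;
376; 48; 255; 19; 170; 18; 335; 179; 281; 49; 476; 88; 282; 123; 313; 1; 194; 439; 300;
349; 154; 25; 98; 385]%num);
  (171, 3, 7, [::
69; 218; 191; 4; 357; 501; 272; 276; 127; 30; 447; 401; 118; 55; 213; 133; 318; 327; 330;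
389; 173; 75; 417; 461; 82; 473; 442; 444; 358; 481; 477; 31; 151; 332; 271; 286; 209;
379; 364; 150; 36; 21; 471; 237; 146; 407; 149; 439; 216; 305; 174; 299; 37; 98; 169; 380;
359; 115; 511; 450; 184; 179; 509; 240; 453; 349; 43; 58; 268; 62; 411; 472; 28; 51; 197;
29; 111; 499; 24; 201; 196; 331; 71; 153; 88; 468; 352; 362; 423; 282; 328; 410; 428; 238;
87; 242; 507; 186; 435; 42; 200; 158; 202; 290; 23; 163; 421; 465; 120; 61; 390; 323; 385;
155; 482; 293; 129; 438; 376; 459; 418; 298; 375; 300; 510; 334; 476; 10; 466; 316; 263;
144; 85; 373; 370; 17; 210; 460; 285; 239; 212; 48; 454; 397; 314; 322; 11; 230; 469; 463;
493; 408; 35; 137; 350; 355; 360; 65; 264; 101; 116; 222; 451; 136; 33; 117; 16; 194; 154;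
393; 180; 170; 113; 433; 38; 329; 425; 351; 353; 302; 176; 275; 208; 236; 59; 398; 126;
195; 73; 188; 204; 475; 315; 416; 244; 445; 193; 424; 399; 310; 182; 446; 7; 266; 288;
441; 262; 295; 413; 312; 301; 437; 2; 106; 152; 249; 229; 402; 108; 456; 44; 9; 49; 278;
257; 344; 119; 175; 368; 452; 134; 274; 32; 132; 307; 110; 498; 253; 313; 177; 219; 198;
508; 128; 306; 497; 81; 467; 156; 56; 135; 479; 340; 22; 241; 46; 100; 443; 39; 203; 25;
234; 396; 251; 309; 294; 339; 227; 18; 247; 232; 142; 505; 243; 335; 178; 297; 255; 67;
95; 161; 412; 147; 317; 474; 432; 333; 245; 112; 92; 372; 60; 90; 185; 138; 415; 27; 345;
342; 6; 381; 341; 378; 434; 338; 503; 502; 160; 15; 187; 141; 63; 83; 199; 143; 84; 287;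
455; 250; 321; 14; 440; 64; 458; 72; 383; 291; 96; 490; 157; 449; 53; 167; 279; 80; 86;
430; 248; 211; 131; 487; 325; 512; 258; 148; 105; 429; 252; 366; 13; 233; 52; 91; 382;
506; 491; 343; 496; 486; 3; 66; 217; 365; 89; 19; 235; 94; 394; 109; 50; 79; 422; 8; 391;
159; 326; 347; 172; 225; 283; 47; 494; 41; 414; 123; 70; 121; 190; 371; 289; 124; 224; 97;
256; 103; 284; 296; 130; 395; 57; 409; 45; 470; 99; 207; 308; 246; 400; 183; 336; 462;
448; 403; 171; 104; 34; 140; 484; 270; 223; 303; 189; 304; 420; 495; 324; 492; 320; 254;
504; 76; 265; 74; 181; 374; 292; 436; 369; 354; 93; 5; 281; 356; 367; 431; 392; 20; 206;
386; 480; 337; 269; 12; 226; 404; 311; 125; 426; 220; 68; 192; 122; 214; 485; 78; 26; 419;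
259; 346; 114; 139; 478; 377; 261; 464; 488; 145; 348; 215; 165; 228; 277; 319; 489; 361;
483; 363; 384; 40; 221; 205; 427; 54; 500; 457; 280; 107; 231; 388; 102; 267; 406; 162;
77; 405; 164; 260; 1; 273; 387; 166; 168]%num);
  (175, 3, 51, [::
436; 223; 162; 41; 10; 430; 230; 109; 397; 355; 178; 218; 509; 36; 104; 61; 479; 244; 510;
234; 394; 431; 87; 411; 320; 256; 416; 30; 470; 304; 135; 375; 213; 64; 437; 366; 200;
311; 367; 217; 231; 63; 445; 215; 333; 332; 278; 205; 352; 499; 412; 108; 216; 240; 484;
405; 245; 227; 252; 145; 228; 2; 24; 153; 102; 501; 28; 113; 451; 71; 441; 266; 93; 265;
361; 518; 4; 322; 339; 197; 40; 377; 106; 214; 259; 516; 156; 466; 494; 236; 22; 21; 174;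
300; 88; 38; 3; 29; 260; 489; 94; 298; 143; 161; 248; 224; 146; 66; 454; 194; 381; 189;
80; 249; 289; 126; 190; 407; 314; 491; 288; 86; 474; 327; 515; 48; 478; 173; 426; 341;
273; 486; 6; 150; 110; 105; 417; 203; 176; 485; 130; 121; 293; 319; 475; 199; 363; 307;
138; 111; 159; 235; 292; 424; 76; 287; 251; 85; 472; 453; 210; 14; 92; 357; 233; 166; 183;
177; 269; 374; 208; 370; 447; 59; 136; 257; 365; 442; 351; 250; 440; 83; 318; 505; 139; 7;
95; 460; 115; 449; 476; 410; 57; 504; 74; 172; 316; 480; 388; 237; 477; 261; 399; 306;
340; 433; 91; 157; 423; 69; 271; 243; 98; 471; 181; 270; 462; 114; 369; 463; 487; 428;
301; 371; 192; 383; 152; 196; 469; 211; 284; 56; 419; 359; 456; 524; 165; 201; 78; 55; 16;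
379; 209; 167; 37; 72; 170; 372; 232; 277; 15; 364; 420; 384; 398; 305; 155; 186; 253;
328; 116; 238; 434; 334; 507; 204; 79; 482; 344; 31; 144; 283; 452; 46; 23; 461; 191; 149;
358; 67; 220; 498; 446; 75; 89; 378; 415; 490; 100; 296; 272; 160; 163; 348; 188; 49; 168;
321; 421; 263; 481; 413; 11; 502; 154; 353; 53; 313; 164; 346; 523; 247; 438; 401; 323;
82; 77; 51; 279; 522; 141; 125; 392; 465; 147; 496; 276; 404; 206; 219; 297; 400; 488;
175; 34; 184; 127; 450; 422; 432; 513; 258; 467; 222; 406; 393; 286; 212; 151; 193; 158;
207; 508; 70; 268; 44; 99; 5; 409; 134; 198; 202; 58; 122; 182; 326; 308; 354; 294; 329;
455; 25; 285; 226; 241; 396; 457; 280; 511; 345; 295; 39; 35; 350; 521; 390; 9; 12; 119;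
90; 414; 435; 169; 96; 97; 336; 368; 309; 81; 128; 254; 8; 43; 129; 60; 185; 54; 19; 262;
1; 187; 140; 335; 382; 439; 225; 468; 408; 349; 395; 418; 443; 493; 282; 264; 18; 291;
500; 65; 68; 391; 27; 373; 356; 299; 520; 387; 330; 112; 512; 117; 179; 389; 132; 459;
267; 107; 242; 180; 120; 492; 20; 376; 337; 497; 275; 444; 362; 506; 303; 17; 458; 386;
517; 26; 246; 124; 464; 338; 281; 519; 229; 142; 13; 324; 62; 221; 427; 50; 101; 385; 32;
317; 402; 118; 45; 312; 331; 131; 360; 274; 133; 343; 325; 473; 425; 33; 503; 290; 42; 73;
514; 483; 315; 495; 84; 429; 403; 310; 448; 195; 239; 342; 52; 103; 380; 302; 347; 123;
47; 148; 137; 171; 255]%num);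
  (181, 3, 48, [::
104; 416; 110; 231; 435; 381; 188; 373; 30; 325; 459; 190; 536; 148; 439; 279; 186; 427;
27; 66; 176; 352; 18; 402; 75; 534; 380; 183; 194; 103; 52; 249; 162; 135; 398; 520; 535;
526; 301; 44; 236; 337; 351; 295; 421; 505; 38; 472; 299; 232; 321; 57; 385; 371; 19; 376;
184; 415; 54; 239; 168; 216; 364; 243; 292; 332; 429; 238; 280; 517; 87; 306; 224; 479;
46; 118; 101; 82; 9; 134; 4; 204; 512; 251; 357; 387; 345; 20; 516; 508; 447; 164; 335;
394; 29; 3; 369; 32; 333; 475; 298; 444; 56; 99; 140; 86; 154; 222; 80; 106; 304; 541; 47;
503; 209; 509; 433; 266; 179; 464; 538; 478; 523; 484; 51; 174; 287; 338; 196; 281; 395;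
28; 340; 150; 307; 441; 485; 274; 285; 96; 1; 525; 514; 477; 404; 227; 169; 128; 94; 528;
500; 355; 428; 521; 137; 270; 252; 317; 349; 289; 490; 507; 448; 283; 166; 342; 161; 136;
144; 354; 456; 392; 35; 55; 300; 70; 234; 454; 131; 229; 43; 343; 406; 331; 23; 130; 465;
177; 61; 197; 372; 533; 157; 182; 95; 213; 121; 92; 158; 470; 240; 452; 399; 133; 250;
242; 275; 5; 171; 276; 384; 313; 513; 498; 284; 403; 230; 461; 37; 405; 469; 165; 191;
277; 120; 491; 269; 26; 282; 233; 410; 124; 12; 49; 258; 151; 155; 267; 432; 113; 167; 34;
195; 418; 524; 504; 203; 473; 69; 180; 468; 487; 36; 152; 481; 90; 530; 537; 102; 483;
115; 393; 163; 265; 451; 431; 346; 105; 16; 467; 173; 76; 320; 506; 85; 244; 40; 419; 358;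
41; 296; 323; 262; 379; 127; 141; 383; 100; 7; 424; 114; 205; 407; 347; 256; 314; 328; 21;
123; 217; 341; 129; 156; 192; 245; 408; 138; 471; 64; 423; 488; 305; 210; 50; 518; 382;
83; 33; 309; 206; 60; 463; 436; 388; 495; 288; 81; 297; 327; 88; 367; 422; 442; 215; 445;
434; 119; 368; 515; 71; 220; 117; 132; 273; 6; 540; 271; 198; 438; 199; 303; 496; 172;
308; 97; 316; 48; 360; 63; 145; 336; 91; 370; 539; 413; 112; 14; 255; 411; 246; 79; 497;
8; 78; 386; 356; 261; 178; 502; 219; 241; 77; 365; 350; 65; 494; 223; 31; 474; 531; 58;
522; 458; 84; 425; 42; 489; 226; 116; 143; 25; 142; 17; 390; 93; 414; 248; 212; 218; 482;
532; 201; 374; 519; 202; 437; 529; 334; 62; 39; 417; 476; 443; 193; 253; 221; 486; 311;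
322; 170; 378; 2; 208; 326; 446; 146; 200; 359; 420; 290; 125; 319; 89; 257; 362; 175; 10;
377; 501; 53; 397; 315; 111; 225; 247; 466; 15; 293; 139; 366; 527; 189; 510; 302; 98;
401; 363; 324; 278; 400; 312; 272; 254; 259; 440; 291; 214; 344; 237; 329; 108; 339; 122;
263; 72; 391; 159; 353; 13; 426; 511; 396; 126; 153; 45; 409; 187; 457; 450; 348; 68; 542;
361; 389; 22; 228; 67; 286; 268; 449; 375; 207; 460; 185; 493; 412; 453; 492; 160; 24;
260; 73; 109; 499; 455; 318; 74; 59; 211; 462; 330; 235; 181; 264; 107; 147; 149; 430; 11;
310; 480; 294]%num);
  (183, 3, 13, [::
233; 296; 543; 197; 32; 379; 217; 249; 90; 237; 135; 246; 401; 215; 253; 251; 480; 353;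
329; 502; 318; 498; 202; 121; 9; 432; 410; 177; 35; 400; 367; 423; 382; 174; 373; 420;
454; 31; 355; 28; 295; 20; 205; 407; 449; 213; 304; 362; 44; 123; 378; 317; 95; 486; 218;
523; 540; 404; 415; 146; 1; 27; 129; 345; 527; 512; 21; 10; 468; 419; 139; 360; 22; 117;
92; 440; 390; 347; 3; 199; 539; 175; 98; 77; 170; 389; 151; 331; 79; 493; 185; 366; 64;
495; 13; 299; 314; 507; 145; 352; 477; 505; 14; 163; 319; 394; 315; 456; 91; 341; 316;
250; 277; 71; 192; 339; 89; 346; 263; 186; 435; 194; 17; 203; 200; 457; 282; 349; 311;
428; 383; 431; 286; 294; 548; 131; 82; 358; 183; 75; 521; 509; 396; 60; 226; 350; 38; 393;
144; 198; 81; 445; 388; 288; 272; 463; 40; 227; 291; 514; 16; 48; 292; 45; 434; 65; 433;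
417; 547; 418; 522; 216; 62; 147; 261; 476; 363; 426; 487; 229; 385; 206; 210; 265; 180;
406; 334; 181; 515; 173; 273; 425; 453; 344; 236; 63; 196; 483; 375; 289; 441; 290; 452;
374; 531; 530; 387; 243; 455; 204; 499; 231; 484; 443; 279; 115; 24; 184; 225; 269; 448;
343; 134; 86; 281; 482; 47; 307; 320; 130; 109; 464; 322; 224; 542; 52; 259; 110; 124;
536; 138; 254; 471; 525; 398; 55; 364; 176; 127; 116; 49; 232; 472; 458; 470; 538; 69; 94;
402; 12; 118; 167; 106; 308; 511; 336; 15; 439; 195; 384; 444; 157; 107; 67; 50; 211; 504;
459; 297; 380; 158; 325; 467; 412; 397; 381; 257; 535; 113; 141; 179; 54; 247; 503; 534;
26; 359; 335; 132; 494; 122; 120; 59; 447; 332; 361; 465; 392; 58; 475; 11; 190; 238; 408;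
66; 46; 154; 333; 305; 182; 244; 241; 105; 84; 437; 405; 330; 436; 142; 274; 541; 230; 8;
479; 207; 256; 372; 39; 172; 371; 451; 212; 501; 462; 83; 30; 496; 309; 438; 7; 354; 461;
41; 351; 529; 235; 276; 104; 36; 220; 365; 164; 427; 78; 302; 93; 252; 356; 114; 403; 306;
293; 68; 234; 422; 148; 34; 528; 240; 413; 191; 169; 303; 102; 255; 219; 287; 537; 321;
310; 99; 76; 187; 74; 188; 178; 285; 399; 155; 526; 518; 266; 271; 391; 19; 222; 270; 280;
248; 108; 189; 298; 136; 491; 57; 313; 193; 119; 87; 478; 133; 103; 473; 209; 301; 37;
338; 300; 275; 421; 56; 376; 6; 73; 112; 245; 239; 149; 323; 442; 162; 357; 517; 466; 409;
161; 18; 519; 513; 268; 160; 485; 508; 166; 140; 430; 23; 29; 386; 326; 137; 395; 469;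
284; 492; 42; 97; 411; 520; 208; 490; 25; 544; 2; 414; 264; 201; 546; 342; 33; 262; 545;
260; 370; 100; 101; 278; 80; 489; 510; 43; 126; 53; 4; 524; 5; 488; 61; 88; 152; 516; 416;
337; 500; 429; 506; 424; 348; 340; 369; 214; 460; 125; 450; 533; 267; 497; 221; 70; 128;
223; 446; 328; 368; 532; 159; 258; 312; 96; 143; 171; 72; 51; 150; 85; 153; 111; 377; 324;
481; 283; 327; 165; 242; 168; 474; 156; 228]%num);
  (185, 3, 26, [::
193; 452; 265; 534; 284; 500; 84; 405; 292; 403; 146; 250; 415; 181; 143; 282; 79; 438;
329; 338; 211; 65; 51; 339; 75; 109; 122; 222; 230; 13; 387; 6; 554; 390; 171; 459; 295;
531; 254; 407; 394; 18; 57; 530; 243; 508; 450; 342; 223; 517; 276; 245; 11; 36; 118; 134;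
106; 363; 527; 496; 94; 485; 174; 437; 488; 341; 208; 467; 291; 462; 319; 21; 421; 17;
401; 179; 304; 161; 532; 48; 199; 196; 501; 344; 391; 46; 397; 71; 130; 189; 302; 203;
278; 290; 1; 125; 162; 39; 153; 440; 331; 327; 473; 466; 261; 180; 350; 494; 238; 547; 67;
58; 47; 315; 414; 274; 160; 41; 361; 177; 76; 400; 296; 411; 80; 389; 63; 429; 186; 81;
368; 117; 247; 469; 408; 219; 482; 210; 521; 509; 246; 184; 204; 480; 108; 241; 66; 262;
399; 152; 191; 472; 514; 256; 409; 260; 463; 294; 456; 548; 216; 384; 7; 228; 426; 14;
546; 72; 19; 62; 28; 175; 239; 275; 95; 197; 436; 516; 107; 371; 435; 116; 416; 60; 486;
553; 356; 133; 202; 491; 287; 277; 22; 479; 333; 188; 33; 25; 519; 318; 103; 320; 110;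
259; 237; 59; 157; 428; 147; 20; 515; 70; 127; 101; 185; 528; 112; 461; 443; 242; 448;
102; 257; 56; 131; 424; 526; 464; 535; 533; 279; 190; 229; 235; 444; 214; 349; 83; 2; 372;
90; 332; 544; 379; 231; 154; 255; 9; 447; 264; 221; 269; 365; 187; 86; 139; 525; 150; 551;
98; 507; 549; 42; 43; 54; 510; 381; 404; 35; 483; 40; 99; 477; 432; 132; 502; 128; 345;
300; 217; 412; 364; 226; 23; 49; 144; 410; 433; 314; 457; 271; 163; 283; 248; 120; 192;
307; 224; 37; 505; 53; 142; 383; 406; 97; 512; 87; 312; 538; 352; 64; 215; 541; 513; 89;
402; 373; 522; 398; 140; 354; 50; 323; 104; 183; 380; 301; 293; 539; 91; 281; 15; 82; 493;
151; 308; 484; 324; 289; 24; 73; 136; 123; 348; 77; 201; 346; 458; 351; 336; 453; 137;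
316; 425; 272; 206; 173; 126; 492; 5; 232; 476; 497; 252; 370; 166; 392; 475; 540; 335;
474; 417; 3; 489; 311; 360; 92; 148; 455; 385; 69; 377; 45; 270; 236; 511; 52; 31; 382;
490; 88; 420; 159; 100; 286; 313; 449; 298; 234; 446; 309; 374; 378; 114; 29; 200; 536;
434; 422; 26; 358; 165; 96; 149; 454; 481; 129; 8; 543; 328; 195; 288; 4; 285; 213; 105;
478; 32; 471; 340; 375; 442; 115; 419; 168; 267; 34; 325; 520; 388; 343; 38; 30; 386; 310;
121; 207; 93; 460; 297; 263; 258; 326; 330; 205; 198; 227; 169; 445; 334; 194; 537; 225;
212; 499; 347; 359; 369; 367; 418; 495; 78; 503; 357; 321; 362; 249; 322; 439; 16; 268;
111; 413; 155; 498; 156; 124; 524; 376; 299; 55; 178; 423; 119; 61; 240; 170; 176; 366;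
209; 244; 518; 273; 251; 12; 545; 529; 145; 138; 10; 317; 396; 135; 158; 167; 74; 220;
465; 542; 552; 393; 353; 253; 233; 172; 427; 182; 451; 266; 85; 506; 550; 68; 431; 141;
27; 355; 470; 306; 523; 280; 44; 164; 504; 430; 395; 337; 487; 113; 441; 468; 218; 303;
305]%num)].

(* (m, k, b): the sequencing b of Z_m^2 : Z_k; for the orders 75, 225 and 363 no
   group as above is non-abelian. *)
Definition square_sequencings : seq (nat * nat * seq N) := [::
  (5, 3, [::
7; 45; 73; 61; 62; 35; 9; 68; 36; 2; 38; 40; 66; 15; 11; 4; 59; 32; 31; 21; 58; 26; 33;
37; 72; 8; 48; 19; 20; 42; 56; 53; 52; 30; 17; 10; 51; 60; 29; 71; 63; 69; 34; 12; 46; 39;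
49; 14; 6; 57; 18; 47; 44; 3; 5; 50; 74; 64; 67; 43; 25; 24; 22; 54; 65; 13; 23; 27; 55;
1; 41; 16; 70; 28]%num);
  (5, 9, [::
162; 195; 66; 53; 85; 55; 56; 82; 7; 140; 209; 43; 54; 207; 42; 210; 217; 211; 15; 81; 32;
11; 190; 77; 204; 172; 161; 174; 199; 142; 178; 223; 222; 87; 144; 200; 23; 61; 125; 216;
45; 89; 173; 188; 69; 221; 203; 2; 9; 33; 37; 168; 44; 46; 104; 21; 143; 65; 96; 20; 218;
145; 14; 148; 51; 98; 141; 205; 19; 29; 60; 212; 106; 170; 157; 101; 185; 187; 36; 132;
206; 72; 91; 70; 13; 123; 78; 194; 40; 95; 219; 122; 176; 220; 163; 50; 63; 151; 1; 167;
164; 112; 34; 201; 22; 224; 97; 30; 109; 131; 110; 103; 136; 158; 120; 160; 31; 16; 150;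
214; 213; 121; 25; 52; 49; 41; 38; 100; 99; 73; 88; 67; 48; 149; 111; 80; 138; 180; 166;
68; 184; 127; 17; 139; 177; 175; 183; 186; 146; 128; 116; 64; 124; 159; 153; 130; 202;
215; 114; 133; 117; 171; 62; 24; 108; 182; 134; 181; 193; 58; 189; 198; 57; 39; 137; 102;
113; 5; 197; 115; 75; 83; 76; 169; 147; 71; 92; 165; 152; 119; 4; 6; 90; 105; 86; 179; 27;
3; 156; 84; 208; 59; 107; 79; 126; 8; 155; 135; 154; 74; 192; 47; 12; 35; 18; 10; 196; 93;
118; 28; 94; 129; 191; 26]%num);
  (11, 3, [::
76; 106; 234; 203; 250; 256; 270; 282; 268; 55; 285; 182; 39; 133; 177; 328; 310; 36; 130;
208; 82; 336; 153; 40; 74; 180; 68; 109; 360; 298; 307; 280; 330; 211; 121; 318; 353; 186;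
251; 247; 134; 276; 259; 176; 160; 261; 290; 25; 118; 313; 13; 165; 145; 125; 140; 62; 41;
184; 154; 339; 85; 219; 72; 202; 361; 300; 164; 21; 100; 166; 321; 357; 231; 58; 10; 299;
305; 93; 216; 185; 348; 192; 292; 16; 18; 281; 94; 227; 139; 312; 122; 274; 34; 345; 142;
197; 175; 333; 156; 172; 356; 225; 218; 317; 51; 88; 240; 12; 209; 168; 267; 354; 264;
162; 178; 114; 212; 331; 48; 254; 324; 89; 78; 83; 344; 277; 228; 148; 5; 123; 95; 56;
159; 284; 64; 204; 91; 99; 63; 315; 135; 115; 255; 19; 61; 27; 341; 286; 230; 60; 143; 84;
57; 181; 174; 73; 112; 111; 244; 47; 37; 206; 131; 304; 191; 120; 157; 329; 24; 316; 308;
87; 67; 362; 98; 71; 223; 108; 113; 54; 6; 340; 102; 32; 210; 355; 147; 265; 296; 116;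
260; 337; 207; 8; 342; 195; 141; 226; 66; 170; 224; 149; 289; 343; 103; 50; 14; 1; 189;
252; 229; 253; 92; 213; 325; 309; 258; 127; 29; 132; 232; 263; 220; 138; 262; 152; 38;
295; 338; 297; 169; 31; 239; 79; 126; 167; 303; 90; 96; 59; 347; 293; 163; 128; 42; 238;
4; 200; 43; 104; 129; 190; 105; 287; 26; 214; 70; 171; 201; 45; 349; 271; 30; 205; 306;
323; 146; 110; 302; 322; 248; 7; 193; 279; 35; 183; 198; 291; 243; 272; 49; 233; 194; 320;
107; 144; 196; 242; 86; 52; 69; 326; 249; 346; 158; 294; 11; 137; 20; 269; 278; 77; 283;
53; 117; 151; 188; 187; 359; 119; 215; 350; 155; 161; 179; 237; 101; 332; 173; 246; 314;
136; 2; 97; 288; 311; 334; 28; 65; 17; 44; 124; 199; 80; 22; 3; 319; 273; 241; 150; 217;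
236; 81; 352; 9; 221; 23; 245; 275; 222; 351; 301; 266; 235; 33; 358; 75; 15; 327; 46;
257; 335]%num)].

(** * Verification of the tables and conclusion *)

(** All the sequences over cyclic normal subgroups are verified here by evaluation: each costs one
    coded product per term and two sorts. *)
Lemma metacyclic_sequencingsP : all metacyclic_check metacyclic_sequencings.
Proof. by vm_compute. Qed.

Lemma square_sequencingsP : all square_check square_sequencings.
Proof. by vm_compute. Qed.

(** The orders are read from the sizes alone, so that looking one up does not evaluate any sequence
    again. *)
Definition sequenced_orders :=
  [seq let: (m, k, _, _) := e in (m * k)%N | e <- metacyclic_sequencings] ++
  [seq let: (m, k, _) := e in (m * m * k)%N | e <- square_sequencings].

Lemma sequenced_ordersP n : n \in sequenced_orders ->
  exists gT : finGroupType, #|gT| = n /\ sequenceable gT.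
Proof.
rewrite mem_cat => /orP[] /mapP[].
  case=> [[[m k] r] b] /(allP metacyclic_sequencingsP) okb ->.
  exact: metacyclic_checkP okb.
case=> [[m k] b] /(allP square_sequencingsP) /and4P[m_gt0 k_gt0 k3 okb] ->.
exact: sequenceable_square m_gt0 k_gt0 k3 okb.
Qed.

(** The link between the two halves of the argument: every odd order in range that fails the
    arithmetic criterion has an entry in one of the tables. Both alternatives are decidable, so this
    is a finite evaluation. *)
Lemma nonabelian_order_sequenced :
  all (fun n => odd n ==> abelian_order n || (n \in sequenced_orders))
    (iota 0 556).
Proof. by vm_compute. Qed.

Theorem theorem2 (n : nat) :
  odd n -> n <= 555 ->
  (exists gT : finGroupType, #|gT| = n /\ ~~ abelian [set: gT]) ->
  exists gT : finGroupType, #|gT| = n /\ sequenceable gT.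
Proof.
move=> odd_n le_n [gT [oG nabG]]; apply: sequenced_ordersP.
(* Membership in [iota 0 556] means n < 556, which is convertible to the assumed bound. *)
have := allP nonabelian_order_sequenced n; rewrite mem_iota odd_n => /(_ le_n).
(* If n passes the arithmetic criterion, the given group would be abelian; the other alternative is
   the goal. *)
case/orP=> // ab_n; case/negP: nabG.
by apply: abelian_orderP; rewrite cardsT oG.
Qed.
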